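(* On a pointer machine one can maintain a sequence of $m$ data nodes $A=\langle A[1],\dots,A[m]\rangle$ with values in a linearly ordered universe, subject to the following operations: \begin{itemize} \item $p_m\gets\texttt{Push}(A[m])$: increases the size of the structure by appending a new last element $A[m]$ and returns a pointer $p_m$ used by other operations to change $A[m]$; this runs in worst-case $O(m)$ time; \item $p\gets\texttt{Peek}(A)$: returns a pointer $p$ to the minimum value in $A$, in worst-case $O(1)$ time; \item $\texttt{DecreaseKey}(p_i,v)$: decreases the value of $A[i]$ to $v$ in worst-case $O(\alpha(i))$ time; \item $\texttt{ChangeKey}(p_i,v)$: increases or decreases the value of $A[i]$ to $v$ in worst-case $O(i)$ time. \end{itemize} Here $\alpha$ denotes the inverse Ackermann function.
   Context: Pointer machine model: memory consists of nodes and directed pointers; data nodes store values from a linearly ordered universe, pointer nodes store $O(1)$ bits, each node has $O(1)$ outgoing pointers; a program uses a constant-size working memory and may only compare nodes, apply constant-size operations to pointer nodes, copy, follow pointers, or halt. Running time counts instructions. *)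

(* Defs.v *)
#[warnings="-notation-overridden"] From mathcomp Require Import all_boot all_order.

Set Implicit Arguments.
Unset Strict Implicit.
Unset Printing Implicit Defensive.

(* The Ackermann-Peter function and its inverse
   alpha n = min { k >= 1 | n <= A(k, k) }.  Starting at k = 1 makes alpha
   positive, so that O(alpha i) is meaningful for every i. *)

Fixpoint ack (m : nat) : nat -> nat :=
  match m with
  | 0 => succn
  | m'.+1 => fix ackm n :=
      match n with
      | 0 => ack m' 1
      | n'.+1 => ack m' (ackm n')
      end
  end.

Lemma ltn_ack m n : n < ack m n.
Proof.
elim: m n => [|m IHm] //; elim=> [|n IHn] /=; first exact: ltnW (IHm 1).
exact: leq_ltn_trans IHn (IHm _).
Qed.

Lemma alpha_subproof n : exists k, (0 < k) && (n <= ack k k).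
Proof. by exists n.+1; exact: ltnW (ltnW (ltn_ack n.+1 n.+1)). Qed.

Definition alpha (n : nat) : nat := ex_minn (alpha_subproof n).

(* Pointer machines with r registers (the working memory), b bits per pointer
   node and d outgoing pointers per node.  A pointer is [None] (null) or the
   address of a node.  Addresses are never visible to programs, and nothing is
   ever deallocated, so memory is the list of all nodes created so far. *)

Definition addr := nat.
Definition pointer := option addr.

(* Execution proceeds to the next instruction of the program, except that
   [Jump] and successful tests continue at the given label (a position in the
   program). *)
Inductive instr (r b d : nat) : Type :=
| Null of 'I_r                   (* x := null                                *)
| Move of 'I_r & 'I_r            (* x := y                                   *)
| New of 'I_r                    (* x := address of a new blank pointer node *)
| Clone of 'I_r & 'I_r           (* x := address of a new copy of node y     *)
| Follow of 'I_r & 'I_r & 'I_d    (* x := j-th outgoing pointer of node y     *)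
| SetPtr of 'I_r & 'I_d & 'I_r    (* j-th outgoing pointer of node x := y     *)
| SetBit of 'I_r & 'I_b & bool   (* j-th bit of pointer node x := constant   *)
| CopyVal of 'I_r & 'I_r         (* value of data node x := value of node y  *)
| IfBit of 'I_r & 'I_b & nat     (* test the j-th bit of pointer node x      *)
| IfEq of 'I_r & 'I_r & nat      (* test whether x and y are the same pointer *)
| IfLe of 'I_r & 'I_r & nat      (* test value of x <= value of y            *)
| Jump of nat
| Halt of 'I_r.                  (* stop, returning the pointer in x         *)

Definition program (r b d : nat) := seq (instr r b d).

Section Machine.

Variables (r b d : nat) (disp : Order.disp_t) (U : orderType disp).

Inductive node : Type :=
| DataNode of U & ('I_d -> pointer)
| PtrNode of ('I_b -> bool) & ('I_d -> pointer).

Definition blank : node := PtrNode (fun=> false) (fun=> None).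

Definition memory := seq node.

Definition deref (h : memory) (p : pointer) : option node := obind (onth h) p.

Definition value_at (h : memory) (p : pointer) : option U :=
  if deref h p is Some (DataNode v _) then Some v else None.

Definition out (n : node) : 'I_d -> pointer :=
  match n with DataNode _ o => o | PtrNode _ o => o end.

Definition set_out (n : node) (j : 'I_d) (q : pointer) : node :=
  match n with
  | DataNode v o => DataNode v [eta o with j |-> q]
  | PtrNode c o => PtrNode c [eta o with j |-> q]
  end.

Record config : Type :=
  Config { pc : nat; regs : 'I_r -> pointer; mem : memory }.

Variant outcome : Type :=
| Next of config
| Done of pointer & memory
| Fault.

Definition step (P : program r b d) (s : config) : outcome :=
  let: Config k R h := s in
  let put x p h' := Next (Config k.+1 [eta R with x |-> p] h') in
  let write a n := Next (Config k.+1 R (set_nth blank h a n)) in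
  let branch (c : bool) l := Next (Config (if c then l else k.+1) R h) in
  match onth P k with
  | Some (Null x) => put x None h
  | Some (Move x y) => put x (R y) h
  | Some (New x) => put x (Some (size h)) (rcons h blank)
  | Some (Clone x y) =>
      if deref h (R y) is Some n then put x (Some (size h)) (rcons h n)
      else Fault
  | Some (Follow x y j) =>
      if deref h (R y) is Some n then put x (out n j) h else Fault
  | Some (SetPtr x j y) =>
      match R x, deref h (R x) with
      | Some a, Some n => write a (set_out n j (R y))
      | _, _ => Fault
      end
  | Some (SetBit x j v) =>
      match R x, deref h (R x) with
      | Some a, Some (PtrNode c o) => write a (PtrNode [eta c with j |-> v] o)
      | _, _ => Fault
      end
  | Some (CopyVal x y) =>
      match R x, deref h (R x), value_at h (R y) with
      | Some a, Some (DataNode _ o), Some v => write a (DataNode v o)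
      | _, _, _ => Fault
      end
  | Some (IfBit x j l) =>
      if deref h (R x) is Some (PtrNode c _) then branch (c j) l else Fault
  | Some (IfEq x y l) => branch (R x == R y) l
  | Some (IfLe x y l) =>
      match value_at h (R x), value_at h (R y) with
      | Some u, Some v => branch (u <= v)%O l
      | _, _ => Fault
      end
  | Some (Jump l) => branch true l
  | Some (Halt x) => Done (R x) h
  | None => Fault
  end.

(* [run P t s = Some (p, h)] iff, from [s], the program [P] halts after at most
   [t] instructions, without a fault, returning [p] and leaving memory [h]. *)
Fixpoint run (P : program r b d) (t : nat) (s : config) :
    option (pointer * memory) :=
  if t is t'.+1 then
    match step P s with
    | Next s' => run P t' s'
    | Done p h => Some (p, h)
    | Fault => None
    end
  else None.

(* The arguments are passed in the first registers; the others are null. *)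
Definition call (P : program r b d) (t : nat) (h : memory)
    (args : seq addr) : option (pointer * memory) :=
  run P t (Config 0 (fun x => onth args x) h).

(* Values enter the machine in new data nodes created by the caller: in
   [supply h v] the node holding [v] has address [size h]. *)
Definition supply (h : memory) (v : U) : memory :=
  rcons h (DataNode v (fun=> None)).

End Machine.

Arguments blank {b d disp U}.

(* The structure is accessed through a fixed header node, passed as first
   argument to every operation. *)
Definition header : addr := 0.

Record structure (r b d : nat) : Type := Structure {
  push : program r b d;
  peek : program r b d;
  decrease_key : program r b d;
  change_key : program r b d
}.

(* An element A[i] of the sequence: the address of its data node, the pointer
   p_i returned when it was pushed, and its current value. *)
Record entry (U : Type) : Type := Entry { loc : addr; handle : addr; key : U }.

Definition with_key (U : Type) (e : entry U) (v : U) : entry U :=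
  Entry (loc e) (handle e) v.

Section Structure.

Variables (r b d : nat) (D : structure r b d).
Variables (disp : Order.disp_t) (U : orderType disp).

Definition stores (h : memory b d U) (A : seq (entry U)) : Prop :=
  forall i e, onth A i = Some e -> value_at h (Some (loc e)) = Some (key e).

(* [reachable h A]: some sequence of operations, starting from the empty
   structure (a single blank header node), leads to memory [h] and is supposed
   to have produced the sequence [A].  The running times [t] are arbitrary
   here. *)
Inductive reachable : memory b d U -> seq (entry U) -> Prop :=
| reachable_empty : reachable [:: blank] [::]
| reachable_push h A v t p h' :
    reachable h A ->
    call (push D) t (supply h v) [:: header; size h] = Some (Some p, h') ->
    reachable h' (rcons A (Entry (size h) p v))
| reachable_peek h A t p h' :
    reachable h A -> 0 < size A ->
    call (peek D) t h [:: header] = Some (p, h') ->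
    reachable h' A
| reachable_decrease_key h A i e v t p h' :
    reachable h A -> onth A i = Some e -> (v <= key e)%O ->
    call (decrease_key D) t (supply h v) [:: header; handle e; size h]
      = Some (p, h') ->
    reachable h' (set_nth e A i (with_key e v))
| reachable_change_key h A i e v t p h' :
    reachable h A -> onth A i = Some e ->
    call (change_key D) t (supply h v) [:: header; handle e; size h]
      = Some (p, h') ->
    reachable h' (set_nth e A i (with_key e v)).

End Structure.

(* Main.v *)
(* The data nodes themselves form a heap-like tree, built in the order of the
   sequence: position 0 is the header, and the parent P i of position i is an
   earlier position.  Every node points to the minimum of its subtree.
   DecreaseKey compares the new key with the minima on the path to the root;
   ChangeKey recomputes these minima from the children, in time proportional to
   the sum of the degrees on the path.  A node i gets about i - P i children,
   so this sum telescopes to O(i).  Each node has a level, its children are one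
   level lower, and a new element becomes a child of the lowest node of the
   rightmost path that is not full.  When that whole path is full, its topmost
   part being a spine of nodes of levels 1, 2, 3, ..., the last spine node
   gets one extra child, the next spine node.  A child reached at distance c
   from its parent has capacity c, hence subtree sizes satisfy the Ackermann
   recursion, the j-th spine node lies beyond A(j - 4, j - 4), and elements
   between it and the next spine node have depth at most 2 j + 1. *)

Require Import Defs.
From mathcomp Require Import all_boot all_order.
From Stdlib Require Import FunctionalExtensionality.
From mathcomp Require Import zify.

Set Implicit Arguments.
Unset Strict Implicit.
Unset Printing Implicit Defensive.

(* The size of a full subtree of level [k] whose root has capacity [c]: when
   [t] nodes are present, the next child has capacity [t] and level [k - 1]. *)
Fixpoint tsize (k : nat) : nat -> nat :=
  match k with
  | 0 => fun=> 1
  | k'.+1 => fix tsize_k c :=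
      if c is c'.+1 then tsize_k c' + tsize k' (tsize_k c') else 1
  end.

Lemma tsizeS k c :
  tsize k.+1 c.+1 = tsize k.+1 c + tsize k (tsize k.+1 c).
Proof. by []. Qed.

Lemma tsize0 k : tsize k 0 = 1. Proof. by case: k. Qed.

Lemma tsize_gt0 k c : 0 < tsize k c.
Proof. by case: k => // k; elim: c => // c IH; rewrite tsizeS addn_gt0 IH. Qed.

Lemma ltn_tsize k c : c < tsize k.+1 c.
Proof.
by elim: c => // c IH; rewrite tsizeS; have := tsize_gt0 k (tsize k.+1 c); lia.
Qed.

(** * Subtree sizes grow at least as fast as the Ackermann function *)

Lemma ackSS k n : ack k.+1 n.+1 = ack k (ack k.+1 n). Proof. by []. Qed.

Lemma ack_ltS k n : ack k n < ack k n.+1.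
Proof. by case: k => // k; rewrite ackSS ltn_ack. Qed.

Lemma leq_ack2 k : {homo ack k : m n / m <= n}.
Proof. by apply: homo_leq => // [? ? ?|n]; [exact: leq_trans | exact/ltnW/ack_ltS]. Qed.

Lemma ack_leS k n : ack k n <= ack k.+1 n.
Proof.
by case: n => [|n]; [exact/ltnW/ack_ltS | rewrite ackSS leq_ack2 ?ltn_ack].
Qed.

Lemma leq_ack1 n : {homo ack^~ n : k l / k <= l}.
Proof. by apply: homo_leq => // [? ? ?|k]; [exact: leq_trans | exact: ack_leS]. Qed.

(** Both functions iterate the level below: where [ackSS] applies [ack k] to the previous value,
    [tsizeS] adds at least [tsize k] of it. The offsets 2 fit together, an argument [t.+2] of
    [tsize] playing the role of [t] for [ack]. *)
Lemma ack_tsize k c : ack k c + 2 <= tsize k.+1 c.+2.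
Proof.
elim: k c => [|k IHk] c; first by have := ltn_tsize 0 c.+2; rewrite /=; lia.
elim: c => [|c IHc]; rewrite tsizeS.
  (* [ack k.+1 0] is [ack k 1], so [IHk] needs a positive argument, that is, a size of at least
     3. *)
  have t3 : 2 < tsize k.+2 1.
    by rewrite [tsize k.+2 1]tsizeS tsize0; exact: ltn_tsize k 1.
  have [t tE] : exists t, tsize k.+2 1 = t.+3 by exists (tsize k.+2 1 - 3); lia.
  have := IHk t.+1; rewrite tE; have := @leq_ack2 k 1 t.+1 isT.
  by have -> : ack k.+1 0 = ack k 1 by []; lia.
have [t tE] : exists t, tsize k.+2 c.+2 = t.+2 by exists (tsize k.+2 c.+2 - 2); lia.
have := IHk t; have := @leq_ack2 k (ack k.+1 c) t; rewrite tE ackSS; lia.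
Qed.

(* Capacity and position of the [j]-th spine node, which has level [j.+1]. *)
Fixpoint cap (j : nat) : nat := if j is j'.+1 then tsize j (cap j') else 0.
Fixpoint sp (j : nat) : nat := if j is j'.+1 then sp j' + cap j else 0.

Lemma cap_gt0 j : 0 < cap j.+1. Proof. exact: tsize_gt0. Qed.

Lemma spS j : sp j.+1 = sp j + cap j.+1. Proof. by []. Qed.

Lemma sp_ltS j : sp j < sp j.+1. Proof. by rewrite spS; have := cap_gt0 j; lia. Qed.

Lemma sp_le : {homo sp : i j / i <= j}.
Proof. by apply: homo_leq => // [? ? ?|k]; [exact: leq_trans | exact/ltnW/sp_ltS]. Qed.

Lemma sp_lt : {homo sp : i j / i < j}.
Proof. by move=> i j /sp_le; exact/leq_trans/sp_ltS. Qed.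

Lemma leq_sp j : j <= sp j.
Proof. by elim: j => // j IH; exact: leq_ltn_trans IH (sp_ltS _). Qed.

Lemma leq_cap j : j <= cap j.
Proof. by elim: j => // j IH; exact: leq_ltn_trans IH (ltn_tsize _ _). Qed.

(** The last gap [cap k.+4] alone suffices: it is a subtree size of level [k.+4] with argument
    [cap k.+3], which is at least [k.+3], so [ack_tsize] applies. *)
Lemma ack_sp k : ack k k < sp k.+4.
Proof.
have [t tE] : exists t, cap k.+3 = t.+2.
  by exists (cap k.+3 - 2); have := leq_cap k.+3; lia.
have := ack_tsize k.+3 t; have := leq_cap k.+3.
have : cap k.+4 = tsize k.+4 (cap k.+3) by [].
rewrite [sp _]spS tE => ->.
move=> lt; have : ack k k <= ack k.+3 t.
  by apply: leq_trans (leq_ack1 k _) (leq_ack2 _ _); lia.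
lia.
Qed.

Arguments sp : simpl never.

(** Otherwise [sp j] would exceed [ack k k] for [k = alpha i], and hence [i]. With [lay_depth] this
    bounds depths by [alpha]. *)
Lemma sp_alpha j i : sp j <= i -> j <= alpha i + 3.
Proof.
move=> ji; rewrite leqNgt; apply/negP => lt.
rewrite /alpha in lt; case: ex_minnP lt => k /andP[_ ik] _ lt.
have : sp k.+4 <= sp j by apply: sp_le; lia.
have := ack_sp k; lia.
Qed.

Lemma alpha_gt0 i : 0 < alpha i.
Proof. by rewrite /alpha; case: ex_minnP => k /andP[]. Qed.

(** * The shape of the tree *)

Definition set_at (T : Type) (f : nat -> T) (n : nat) (x : T) : nat -> T :=
  fun i => if i == n then x else f i.

Arguments set_at : simpl never.

Lemma set_at_eq (T : Type) (f : nat -> T) n x : set_at f n x n = x.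
Proof. by rewrite /set_at eqxx. Qed.

Lemma set_at_neq (T : Type) (f : nat -> T) n x i : i != n -> set_at f n x i = f i.
Proof. by rewrite /set_at => /negPf ->. Qed.

(* In decreasing order, as they are linked in memory. *)
Fixpoint kids (P : nat -> nat) (m i : nat) : seq nat :=
  if m is m'.+1 then
    if P m == i then m :: kids P m' i else kids P m' i
  else [::].

Lemma mem_kids P m i j : (j \in kids P m i) = (0 < j <= m) && (P j == i).
Proof.
elim: m j => [|m IH] j /=; first by rewrite in_nil; case: j.
have -> : (0 < j <= m.+1) = (j == m.+1) || (0 < j <= m) by lia.
have [->|jm] := eqVneq j m.+1.
  by case: (P m.+1 == i); rewrite ?mem_head // IH ltnn andbF.
by case: (P m.+1 == i); rewrite ?in_cons ?(negPf jm) IH.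
Qed.

Lemma eq_kids P P' m i : {in [pred j | j <= m], P =1 P'} -> kids P m i = kids P' m i.
Proof.
elim: m => //= m IH e; rewrite e ?inE // IH // => j jm.
by apply: e; rewrite !inE in jm *; lia.
Qed.

Lemma kids_nil P m i : (forall j, 0 < j <= m -> P j < j) -> m <= i ->
  kids P m i = [::].
Proof.
move=> lt_P mi; apply/eqP; rewrite -size_eq0 -leqn0 leqNgt -has_predT.
by apply/hasPn => j; rewrite mem_kids => /andP[jm /eqP Pj]; have := lt_P j jm; lia.
Qed.

(** A spine node is the one that encodes its own level, so in memory its [lvl] link points to
    itself. The header counts as spine node 0. *)
Definition spine (K : nat -> nat) (i : nat) : bool :=
  (0 < K i) && (sp (K i).-1 == i).

(* [P i], [K i] and [u i] are the parent, the level and the used capacity of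
   position [i]; the capacity is [i - P i], and leaves (level 0) count as full.
   [lay_path] describes the rightmost path: the last of [q.+1] ordinary
   children of [p] is at position [p + tsize (K p) q]. *)
Record layout (m : nat) (P K u : nat -> nat) : Prop := Layout {
  lay_P0 : P 0 = 0;
  lay_K0 : K 0 = 1;
  lay_P : forall i, 0 < i <= m -> P i < i;
  lay_root : forall i, 0 < i <= m -> P i = 0 -> i = 1;
  lay_u : forall i, 0 < i <= m -> u i <= i - P i;
  lay_leaf : forall i, 0 < i <= m -> K i = 0 -> u i = i - P i;
  lay_spine : forall i, 0 < i <= m -> spine K i ->
    exists j, [/\ i = sp j.+1, P i = sp j & K i = j.+2];
  lay_level : forall i, 0 < i <= m -> ~~ spine K i ->
    [/\ 0 < P i, 0 < K (P i), K i = (K (P i)).-1 & sp (K i).-1 < i];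
  lay_anchor : forall i k, i <= m -> k.+1 < K i -> P (sp k.+1) = sp k;
  lay_path : forall t c, c = iter t P m -> 0 < c -> ~~ spine K c ->
    0 < u (P c) /\ c = P c + tsize (K (P c)) (u (P c)).-1;
  lay_last : 0 < m -> tsize (K m) (u m) = 1;
  lay_kids : forall i, 0 < i <= m ->
    size (kids P m i) <= u i + (spine K i && (sp (K i) <= m));
  lay_depth : forall i, i <= m -> exists n j,
    [/\ iter n P i = 0, n + K i <= j.*2.+1 & sp j <= i] }.

Lemma layout0 : layout 0 (fun=> 0) (fun=> 1) (fun=> 0).
Proof.
split=> //; try by case.
- by move=> [|t] c ->.
- by case=> // _; exists 0, 0.
Qed.

(** * Extending a layout by one position *)

Section Layout.

Variables (m : nat) (P K u : nat -> nat).
Hypothesis lay : layout m P K u.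

Lemma lay_P_le i : i <= m -> P i <= i.
Proof.
by case: i => [|i] im; [rewrite (lay_P0 lay) | apply/ltnW/(lay_P lay)].
Qed.

Lemma lay_iter_le t i : i <= m -> iter t P i <= i.
Proof.
move=> im; elim: t => //= t IH; apply: (leq_trans (lay_P_le _) IH).
exact: leq_trans IH im.
Qed.

(** This makes the encoding of levels meaningful: [lvl] links lead only to nodes that already
    exist. *)
Lemma lay_sp_le i : 0 < i <= m -> sp (K i).-1 <= i.
Proof.
move=> im; have [s|s] := boolP (spine K i); first by case/andP: s => _ /eqP ->.
by apply: ltnW; case: (lay_level lay im s).
Qed.

(** The free position [m.+1] comes right after the subtree of [c]. As [c] is the last ordinary child
    of [P c], its offset [c - P c] is the size of what precedes it there; when [c] is full this
    offset is also its used capacity, and [tsizeS] adds up the two parts. *)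
Lemma lay_climb t c : c = iter t P m -> 0 < c <= m -> ~~ spine K c ->
  m.+1 = c + tsize (K c) (u c) -> u c = c - P c ->
  0 < P c <= m /\ m.+1 = P c + tsize (K (P c)) (u (P c)).
Proof.
move=> ct cm s mE uc; have [P0 KP KE _] := lay_level lay cm s.
have [u0 cE] := lay_path lay ct (proj1 (andP cm)) s.
have Pc := lay_P lay cm; split; first by lia.
rewrite -(prednK KP) -(prednK u0) tsizeS prednK // -KE.
have -> : tsize (K (P c)) (u (P c)).-1 = c - P c by lia.
by rewrite -uc; lia.
Qed.

(** [cap j.+2] is by definition the size of the full subtree of spine node [j.+1], so the position
    behind that subtree is [sp j.+2]. *)
Lemma lay_full_spine t c : c = iter t P m -> 0 < c <= m -> spine K c ->
  m.+1 = c + tsize (K c) (u c) -> u c = c - P c ->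
  exists j, [/\ c = sp j.+1, K c = j.+2 & m.+1 = sp j.+2].
Proof.
move=> ct cm s mE uc; have [j [cE PE KE]] := lay_spine lay cm s.
exists j; split=> //; rewrite mE uc KE PE spS cE spS addKn.
by [].
Qed.

Let nP c := set_at P m.+1 c.

Lemma iter_set_at c t i : i <= m -> iter t (nP c) i = iter t P i.
Proof.
move=> im; elim: t => //= t ->; rewrite /nP set_at_neq //.
by have := lay_iter_le t im; lia.
Qed.

Lemma kids_set_at c i :
  kids (nP c) m.+1 i = if c == i then m.+1 :: kids P m i else kids P m i.
Proof.
rewrite /= {1}/nP set_at_eq.
suff -> : kids (nP c) m i = kids P m i by [].
by apply: eq_kids => j; rewrite !inE => jm; rewrite /nP set_at_neq //; lia.
Qed.

Lemma spine_set_at k i : i <= m -> spine (set_at K m.+1 k) i = spine K i.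
Proof. by move=> im; rewrite /spine set_at_neq //; lia. Qed.

(** The new capacity [m.+1 - c] is the present size of the subtree of [c], as in the recursion of
    [tsize]. A new leaf counts as full at once; any other new node starts with nothing used. *)
Lemma layout_child t c : c = iter t P m -> 0 < c <= m ->
    m.+1 = c + tsize (K c) (u c) -> u c < c - P c ->
  let k := (K c).-1 in
  layout m.+1 (set_at P m.+1 c) (set_at K m.+1 k)
    (set_at (set_at u c (u c).+1) m.+1 (if k == 0 then m.+1 - c else 0)).
Proof.
move=> ct cm mE uc k.
have K0 : 0 < K c.
  by rewrite lt0n; apply/eqP => K0; have := lay_leaf lay cm K0; lia.
have ne i : i <= m -> i != m.+1 by lia.
(* The new node lies strictly beyond the spine node of its level, so it is not a spine node
   itself. *)
have spk : sp k.-1 < m.+1.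
  have : sp k.-1 <= sp k by apply: sp_le; lia.
  by have := lay_sp_le cm; rewrite -/k; lia.
have nsp : ~~ spine (set_at K m.+1 k) m.+1.
  by rewrite /spine set_at_eq negb_and; apply/orP; right; rewrite neq_ltn spk.
have cne : c != m.+1 by lia.
split.
- by rewrite set_at_neq // (lay_P0 lay).
- by rewrite set_at_neq // (lay_K0 lay).
- move=> i im; have [->|ie] := eqVneq i m.+1; first by rewrite set_at_eq; lia.
  by rewrite set_at_neq //; apply: (lay_P lay); lia.
- move=> i im; have [->|ie] := eqVneq i m.+1; first by rewrite set_at_eq; lia.
  by rewrite set_at_neq //; apply: (lay_root lay); lia.
- move=> i im; have [->|ie] := eqVneq i m.+1.
    by rewrite !set_at_eq; case: ifP.
  rewrite !(set_at_neq _ _ ie); have [->|ic] := eqVneq i c.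
    by rewrite set_at_eq.
  by rewrite set_at_neq //; apply: (lay_u lay); lia.
- move=> i im; have [->|ie] := eqVneq i m.+1.
    by rewrite !set_at_eq => ->.
  rewrite !(set_at_neq _ _ ie); have [->|ic] := eqVneq i c; first by lia.
  by rewrite set_at_neq //; apply: (lay_leaf lay); lia.
- move=> i im; have [->|ie] := eqVneq i m.+1; first by rewrite (negPf nsp).
  rewrite spine_set_at ?set_at_neq //; last lia.
  by apply: (lay_spine lay); lia.
- move=> i im; have [->|ie] := eqVneq i m.+1.
    by rewrite !set_at_eq (set_at_neq _ _ cne); split=> //; lia.
  rewrite spine_set_at; last lia.
  have im' : 0 < i <= m by lia.
  have Pi := lay_P lay im'.
  rewrite !(set_at_neq _ _ ie) (@set_at_neq _ K); last lia.
  exact: (lay_level lay).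
- move=> i k' im; have [->|ie] := eqVneq i m.+1.
    rewrite set_at_eq => kk; have spc : sp k'.+1 <= sp k by apply: sp_le; lia.
    rewrite set_at_neq; last by have := lay_sp_le cm; rewrite -/k; lia.
    by apply: (lay_anchor lay (i := c)); lia.
  rewrite (set_at_neq _ _ ie) => kk.
  have im' : 0 < i <= m.
    by case: (posnP i) kk => [->|i0 _]; [rewrite (lay_K0 lay) | lia].
  have spi : sp k'.+1 <= sp (K i).-1 by apply: sp_le; lia.
  rewrite set_at_neq; last by have := lay_sp_le im'; lia.
  by apply: (lay_anchor lay (i := i)); lia.
- case=> [|s] d -> /=.
    by move=> _ _; rewrite (set_at_eq P) !(set_at_neq _ _ cne) set_at_eq.
  rewrite -iterS iterSr set_at_eq iter_set_at; last lia.
  have : iter s P c <= m by rewrite ct -iterD; apply: lay_iter_le.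
  set e := iter s P c => em e0.
  have Pe := lay_P_le em; have Pe' := lay_P lay (_ : 0 < e <= m).
  rewrite spine_set_at // => se.
  rewrite !(@set_at_neq _ _ m.+1); try lia.
  (* Among old nodes only [c] has a new counter, and [P e < e <= c]. *)
  rewrite set_at_neq; last first.
    have : e <= c by rewrite /e; apply: lay_iter_le; lia.
    by have := Pe' (introT andP (conj e0 em)); lia.
  by apply: (lay_path lay (t := s + t)) => //; rewrite iterD -ct.
- by rewrite !set_at_eq; case: ifPn => [/eqP -> //|_ _]; rewrite tsize0.
- move=> i im; rewrite kids_set_at; have [->|ie] := eqVneq i m.+1.
    rewrite (negPf cne) set_at_eq.
    by rewrite kids_nil //; exact: lay_P lay.
  have im' : 0 < i <= m by lia.
  rewrite spine_set_at ?(set_at_neq _ _ ie); last lia.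
  have := lay_kids lay im'; rewrite [c == i]eq_sym.
  have le : nat_of_bool (spine K i && (sp (K i) <= m)) <=
      spine K i && (sp (K i) <= m.+1) by lia.
  have [->|ic] := eqVneq i c; rewrite ?set_at_eq ?set_at_neq //=; lia.
- move=> i im; have [->|ie] := eqVneq i m.+1.
    (* The child is one step deeper and one level lower, so the sum of depth and level is that of
       [c]. *)
    have [n [j [n0 nK jc]]] := lay_depth lay (proj2 (andP cm)).
    exists n.+1, j; rewrite iterSr set_at_eq iter_set_at ?set_at_eq; last lia.
    by split=> //; rewrite /k; lia.
  have im' : i <= m by lia.
  have [n [j [n0 nK jc]]] := lay_depth lay im'.
  by exists n, j; rewrite iter_set_at // set_at_neq.
Qed.

(** The next spine node is an extra child, so the used capacity of [sp j] stays the same. The case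
    [j = 0] is the insertion of the first element below the header. *)
Lemma layout_spine t j : sp j = iter t P m -> K (sp j) = j.+1 -> m.+1 = sp j.+1 ->
  layout m.+1 (set_at P m.+1 (sp j)) (set_at K m.+1 j.+2) (set_at u m.+1 0).
Proof.
set c := sp j => ct Kc mE.
have cm : c <= m by rewrite ct; apply: lay_iter_le.
have cne : c != m.+1 by lia.
have spn : spine (set_at K m.+1 j.+2) m.+1.
  by rewrite /spine set_at_eq /= mE.
split.
- by rewrite set_at_neq // (lay_P0 lay).
- by rewrite set_at_neq // (lay_K0 lay).
- move=> i im; have [->|ie] := eqVneq i m.+1; first by rewrite set_at_eq; lia.
  by rewrite set_at_neq //; apply: (lay_P lay); lia.
- move=> i im; have [->|ie] := eqVneq i m.+1.
    rewrite set_at_eq /c => c0.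
    have j0 : j = 0 by have := leq_sp j; lia.
    by rewrite mE j0.
  by rewrite set_at_neq //; apply: (lay_root lay); lia.
- move=> i im; have [->|ie] := eqVneq i m.+1; first by rewrite !set_at_eq.
  by rewrite !(set_at_neq _ _ ie); apply: (lay_u lay); lia.
- move=> i im; have [->|ie] := eqVneq i m.+1; first by rewrite !set_at_eq.
  by rewrite !(set_at_neq _ _ ie); apply: (lay_leaf lay); lia.
- move=> i im; have [->|ie] := eqVneq i m.+1.
    by exists j; rewrite !set_at_eq.
  rewrite spine_set_at ?set_at_neq //; last lia.
  by apply: (lay_spine lay); lia.
- move=> i im; have [->|ie] := eqVneq i m.+1; first by rewrite spn.
  rewrite spine_set_at; last lia.
  have im' : 0 < i <= m by lia.
  have Pi := lay_P lay im'.
  rewrite !(set_at_neq _ _ ie) (@set_at_neq _ K); last lia.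
  exact: (lay_level lay).
- move=> i k' im; have [->|ie] := eqVneq i m.+1.
    rewrite set_at_eq => kk; have [->|kj] := eqVneq k' j.
      by rewrite -mE set_at_eq.
    have spc : sp k'.+1 <= c by apply: sp_le; lia.
    rewrite set_at_neq; last lia.
    by apply: (lay_anchor lay (i := c)); lia.
  rewrite (set_at_neq _ _ ie) => kk.
  have im' : 0 < i <= m.
    by case: (posnP i) kk => [->|i0 _]; [rewrite (lay_K0 lay) | lia].
  have spi : sp k'.+1 <= sp (K i).-1 by apply: sp_le; lia.
  rewrite set_at_neq; last by have := lay_sp_le im'; lia.
  by apply: (lay_anchor lay (i := i)); lia.
- case=> [|s] d -> /=; first by rewrite spn.
  rewrite -iterS iterSr set_at_eq iter_set_at; last lia.
  have : iter s P c <= m by rewrite ct -iterD; apply: lay_iter_le.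
  set e := iter s P c => em e0.
  have Pe := lay_P_le em.
  rewrite spine_set_at // => se.
  rewrite !(@set_at_neq _ _ m.+1); try lia.
  by apply: (lay_path lay (t := s + t)) => //; rewrite iterD -ct.
- by rewrite !set_at_eq tsize0.
- move=> i im; rewrite kids_set_at; have [->|ie] := eqVneq i m.+1.
    rewrite (negPf cne) set_at_eq.
    by rewrite kids_nil //; exact: lay_P lay.
  have im' : 0 < i <= m by lia.
  rewrite spine_set_at ?(set_at_neq _ _ ie); last lia.
  have := lay_kids lay im'; rewrite [c == i]eq_sym.
  have [->|ic] := eqVneq i c.
    (* The boolean term of [lay_kids] turns from 0 to 1 here and pays for the extra child. *)
    by rewrite /spine Kc /= eqxx /= -mE leqnn ltnn /=; lia.
  lia.
- move=> i im; have [->|ie] := eqVneq i m.+1.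
    have [n [j' [n0 nK jc]]] := lay_depth lay cm.
    (* Depth and level both grow by one, which passing from [j'] to [j.+1] allows. *)
    have jj : j' <= j.
      by rewrite leqNgt; apply/negP => /sp_lt; rewrite -/c; lia.
    exists n.+1, j.+1; rewrite iterSr set_at_eq iter_set_at ?set_at_eq; last lia.
    by split=> //; [rewrite Kc in nK; lia | rewrite -mE].
  have im' : i <= m by lia.
  have [n [j' [n0 nK jc]]] := lay_depth lay im'.
  by exists n, j'; rewrite iter_set_at // set_at_neq.
Qed.

End Layout.

(** * Programs *)

Definition r0 : 'I_8 := @Ordinal 8 0 isT.
Definition r1 : 'I_8 := @Ordinal 8 1 isT.
Definition r2 : 'I_8 := @Ordinal 8 2 isT.
Definition r3 : 'I_8 := @Ordinal 8 3 isT.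
Definition r4 : 'I_8 := @Ordinal 8 4 isT.
Definition r5 : 'I_8 := @Ordinal 8 5 isT.
Definition r6 : 'I_8 := @Ordinal 8 6 isT.
Definition r7 : 'I_8 := @Ordinal 8 7 isT.

(* [cur] moves backwards along the [prv] links, from a node towards its parent,
   by one position for each ordinary child; the node is full when it gets
   there.  [lvl] encodes a level [k.+1] by the [k]-th spine node, and level 0 by
   null.  [fc] and [sib] link the children, the latest one first; [best] is the
   minimum of the subtree.  In the header, [prv] is the last element. *)
Definition par : 'I_7 := @Ordinal 7 0 isT.
Definition lvl : 'I_7 := @Ordinal 7 1 isT.
Definition cur : 'I_7 := @Ordinal 7 2 isT.
Definition prv : 'I_7 := @Ordinal 7 3 isT.
Definition fc : 'I_7 := @Ordinal 7 4 isT.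
Definition sib : 'I_7 := @Ordinal 7 5 isT.
Definition best : 'I_7 := @Ordinal 7 6 isT.

Lemma onth_nthE (T : Type) (x0 : T) s i :
  onth s i = if i < size s then Some (nth x0 s i) else None.
Proof. by elim: s i => [|x s IH] [|i] //=; rewrite IH. Qed.

Lemma onth_set_nth (T : Type) (x0 y : T) s i j : i < size s ->
  onth (set_nth x0 s i y) j = if j == i then Some y else onth s j.
Proof.
move=> si; rewrite !(onth_nthE x0) size_set_nth nth_set_nth /= (maxn_idPr si).
by case: eqP => [->|//]; rewrite si.
Qed.

(** * Memory updates and timed execution rules *)

Section Exec.

Variables (disp : Order.disp_t) (U : orderType disp).
Implicit Types (h : memory 0 7 U) (P : program 8 0 7) (s : seq pointer).

(** Register files given as lists can be evaluated by simplification. *)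
Definition rf s : 'I_8 -> pointer := fun i => nth None s i.

(** The null default for missing nodes makes a freshly supplied data node, whose links are null,
    invisible to [fld]. *)
Definition fld h (j : 'I_7) (a : addr) : pointer :=
  if onth h a is Some n then out n j else None.

Definition val h (a : addr) : option U := value_at h (Some a).

Definition upd h a j q : memory 0 7 U :=
  set_nth blank h a (set_out (nth blank h a) j q).

Definition putv h a v : memory 0 7 U :=
  set_nth blank h a (DataNode _ v (out (nth blank h a))).

Lemma rf_set s (x : 'I_8) p :
  ([eta rf s with x |-> p] : 'I_8 -> pointer) = rf (set_nth None s x p).
Proof.
apply: functional_extensionality => i.
rewrite /rf nth_set_nth /=; case: eqP => [->|/eqP]; first by rewrite eqxx.
by rewrite -val_eqE => /negPf ->.
Qed.

Lemma size_upd h a j q : a < size h -> size (upd h a j q) = size h.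
Proof. by rewrite size_set_nth => /maxn_idPr. Qed.

Lemma lt_upd h a j q b : b < size h -> b < size (upd h a j q).
Proof. by rewrite size_set_nth => bh; rewrite leq_max bh orbT. Qed.

Lemma size_putv h a v : a < size h -> size (putv h a v) = size h.
Proof. by rewrite size_set_nth => /maxn_idPr. Qed.

Lemma fld_upd h a j q j' a' : a < size h ->
  fld (upd h a j q) j' a' = if (a' == a) && (j' == j) then q else fld h j' a'.
Proof.
move=> ah; rewrite /fld onth_set_nth //; case: eqP => // ->.
rewrite (onth_nthE blank) ah; case: (nth _ _ _) => [v o|c o] /=;
by case: eqP.
Qed.

Lemma val_upd h a j q a' : a < size h -> val (upd h a j q) a' = val h a'.
Proof.
move=> ah; rewrite /val /value_at /= onth_set_nth //; case: eqP => // ->.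
by rewrite (onth_nthE blank) ah; case: (nth _ _ _).
Qed.

Lemma fld_putv h a v j a' : a < size h -> fld (putv h a v) j a' = fld h j a'.
Proof.
move=> ah; rewrite /fld onth_set_nth //; case: eqP => // ->.
by rewrite (onth_nthE blank) ah.
Qed.

Lemma val_putv h a v a' : a < size h ->
  val (putv h a v) a' = if a' == a then Some v else val h a'.
Proof. by move=> ah; rewrite /val /value_at /= onth_set_nth //; case: eqP. Qed.

Lemma size_supply h v : size (supply h v) = (size h).+1.
Proof. exact: size_rcons. Qed.

Lemma fld_supply h v j a : fld (supply h v) j a = fld h j a.
Proof.
rewrite /fld !(onth_nthE blank) size_rcons nth_rcons ltnS.
by case: ltngtP => // ->; rewrite eqxx.
Qed.

Lemma val_supply h v a : val (supply h v) a = if a == size h then Some v else val h a.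
Proof.
rewrite /val /value_at /= !(onth_nthE blank) size_rcons nth_rcons ltnS.
by case: ltngtP => // ->; rewrite eqxx.
Qed.

Lemma val_lt h a : val h a -> a < size h.
Proof. by rewrite /val /value_at /= (onth_nthE blank); case: ifP. Qed.

Lemma fld_default h j a : size h <= a -> fld h j a = None.
Proof. by rewrite /fld (onth_nthE blank) ltnNge => ->. Qed.

(** A total-correctness judgement with a time budget; each rule below spends one unit of [t]. *)
Definition halts P t c (Q : pointer -> memory 0 7 U -> Prop) : Prop :=
  exists q h', run P t c = Some (q, h') /\ Q q h'.

Lemma run_le P t t' (c : config 8 0 7 U) x :
  t <= t' -> run P t c = Some x -> run P t' c = Some x.
Proof.
elim: t t' c => // t IH [//|t'] c; rewrite ltnS /= => tt'.
by case: (step P c) => // c'; apply: IH.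
Qed.

(** [reachable] admits arbitrary running times; this identifies its outcomes with those of the
    time-bounded runs. *)
Lemma run_det P t t' (c : config 8 0 7 U) x y :
  run P t c = Some x -> run P t' c = Some y -> x = y.
Proof.
move=> /(run_le (leq_maxl t t')) e /(run_le (leq_maxr t t')).
by rewrite e => -[].
Qed.

Lemma halts_le P t t' c Q : t <= t' -> halts P t c Q -> halts P t' c Q.
Proof. by move=> tt' [q [h' [/(run_le tt') e Qh]]]; exists q, h'. Qed.

Lemma halts_imp P t c (Q Q' : pointer -> memory 0 7 U -> Prop) :
  (forall q h, Q q h -> Q' q h) -> halts P t c Q -> halts P t c Q'.
Proof. by move=> QQ' [q [h [e /QQ' Qh]]]; exists q, h. Qed.

Section Rules.

Variables (P : program 8 0 7) (t k : nat) (s : seq pointer).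
Variables (h : memory 0 7 U) (Q : pointer -> memory 0 7 U -> Prop).

Lemma halts_move x y : onth P k = Some (Move _ _ x y) ->
  halts P t (Config k.+1 (rf (set_nth None s x (nth None s y))) h) Q ->
  halts P t.+1 (Config k (rf s) h) Q.
Proof. by rewrite /halts /= => ->; rewrite -rf_set. Qed.

Lemma halts_follow x y j a : onth P k = Some (Follow _ x y j) ->
  nth None s y = Some a -> a < size h ->
  halts P t (Config k.+1 (rf (set_nth None s x (fld h j a))) h) Q ->
  halts P t.+1 (Config k (rf s) h) Q.
Proof.
rewrite /halts /= => -> sy ah; rewrite [rf s y]sy /deref /= /fld.
by rewrite (onth_nthE blank) ah -rf_set.
Qed.

Lemma halts_setptr x j y a : onth P k = Some (SetPtr _ x j y) ->
  nth None s x = Some a -> a < size h ->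
  halts P t (Config k.+1 (rf s) (upd h a j (nth None s y))) Q ->
  halts P t.+1 (Config k (rf s) h) Q.
Proof.
rewrite /halts /= => -> sx ah; rewrite [rf s x]sx /deref /=.
by rewrite (onth_nthE blank) ah.
Qed.

Lemma halts_copyval x y a b v : onth P k = Some (CopyVal _ _ x y) ->
  nth None s x = Some a -> val h a -> nth None s y = Some b -> val h b = Some v ->
  halts P t (Config k.+1 (rf s) (putv h a v)) Q ->
  halts P t.+1 (Config k (rf s) h) Q.
Proof.
rewrite /halts /= => -> sx va sy; rewrite [rf s x]sx [rf s y]sy /val => ->.
move: (va); rewrite /val /value_at /deref /= /putv (onth_nthE blank).
by case: ifP => // _; case: (nth _ _ _).
Qed.

Lemma halts_ifeq x y l : onth P k = Some (IfEq _ _ x y l) ->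
  halts P t (Config (if nth None s x == nth None s y then l else k.+1) (rf s) h) Q ->
  halts P t.+1 (Config k (rf s) h) Q.
Proof. by rewrite /halts /= => ->. Qed.

Lemma halts_ifle x y l a b v w : onth P k = Some (IfLe _ _ x y l) ->
  nth None s x = Some a -> nth None s y = Some b ->
  val h a = Some v -> val h b = Some w ->
  halts P t (Config (if (v <= w)%O then l else k.+1) (rf s) h) Q ->
  halts P t.+1 (Config k (rf s) h) Q.
Proof.
by rewrite /halts /= => -> sx sy; rewrite [rf s x]sx [rf s y]sy /val => -> ->.
Qed.

Lemma halts_jump l : onth P k = Some (Jump _ _ _ l) ->
  halts P t (Config l (rf s) h) Q -> halts P t.+1 (Config k (rf s) h) Q.
Proof. by rewrite /halts /= => ->. Qed.

Lemma halts_halt x : onth P k = Some (Halt _ _ x) ->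
  Q (nth None s x) h -> halts P t.+1 (Config k (rf s) h) Q.
Proof. by rewrite /halts /= => -> ?; exists (nth None s x), h. Qed.

End Rules.

Lemma halts_call P t h args (Q : pointer -> memory 0 7 U -> Prop) :
  halts P t (Config 0 (rf (map Some args ++ nseq (8 - size args) None)) h) Q ->
  exists q h', call P t h args = Some (q, h') /\ Q q h'.
Proof.
rewrite /halts /call.
suff -> : rf (map Some args ++ nseq (8 - size args) None) = (fun x => onth args x).
  by [].
apply: functional_extensionality => i; rewrite /rf nth_cat size_map onthE.
by case: ltnP => // le; rewrite nth_nseq if_same nth_default // size_map.
Qed.

End Exec.

(* Registers: [r0] header, [r1] element with the new key, [r2] current node. *)
Definition uploop (o : nat) : program 8 0 7 :=
  [:: IfEq _ _ r2 r0 (o + 7);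
      Follow _ r3 r2 best;
      IfLe _ _ r1 r3 (o + 4);
      Jump _ _ _ (o + 5);
      SetPtr _ r2 best r1;
      Follow _ r2 r2 par;
      Jump _ _ _ o;
      Halt _ _ r1].

Definition decrease_prog : program 8 0 7 :=
  [:: CopyVal _ _ r1 r2; Move _ _ r2 r1] ++ uploop 2.

(* The outer loop (2-14) climbs with [r2]; the inner loop (5-11) lets [r4] range
   over the children of [r2] and keeps the best candidate in [r3]. *)
Definition change_prog : program 8 0 7 :=
  [:: CopyVal _ _ r1 r2;
      Move _ _ r2 r1;
      IfEq _ _ r2 r0 15;
      Move _ _ r3 r2;
      Follow _ r4 r2 fc;
      IfEq _ _ r4 r7 12;
      Follow _ r5 r4 best;
      IfLe _ _ r5 r3 9;
      Jump _ _ _ 10;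
      Move _ _ r3 r5;
      Follow _ r4 r4 sib;
      Jump _ _ _ 5;
      SetPtr _ r2 best r3;
      Follow _ r2 r2 par;
      Jump _ _ _ 2;
      Halt _ _ r1].

Definition peek_prog : program 8 0 7 :=
  [:: Follow _ r1 r0 fc; Follow _ r1 r1 best; Halt _ _ r1].

(* [r1] new element, [r2] candidate parent, [r3] last element, [r7] null.
   Climb along full nodes (3-5, 16-19), then add an ordinary child (6-15) or
   the next spine node (22-23; via 20-21 if it is the first element), link the
   new element (24-30) and propagate its key. *)
Definition push_prog : program 8 0 7 :=
  [:: Follow _ r3 r0 prv;
      Move _ _ r2 r3;
      IfEq _ _ r2 r7 20;
      Follow _ r4 r2 cur;
      Follow _ r5 r2 par;
      IfEq _ _ r4 r5 16;
      Follow _ r4 r4 prv;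
      SetPtr _ r2 cur r4;
      Follow _ r6 r2 lvl;
      Follow _ r6 r6 par;
      SetPtr _ r1 lvl r6;
      IfEq _ _ r6 r7 14;
      SetPtr _ r1 cur r1;
      Jump _ _ _ 24;
      SetPtr _ r1 cur r2;
      Jump _ _ _ 24;
      Follow _ r6 r2 lvl;
      IfEq _ _ r6 r2 22;
      Move _ _ r2 r5;
      Jump _ _ _ 3;
      Move _ _ r2 r0;
      Move _ _ r3 r0;
      SetPtr _ r1 lvl r1;
      SetPtr _ r1 cur r1;
      SetPtr _ r1 par r2;
      SetPtr _ r1 prv r3;
      SetPtr _ r0 prv r1;
      Follow _ r4 r2 fc;
      SetPtr _ r1 sib r4;
      SetPtr _ r2 fc r1;
      SetPtr _ r1 best r1;
      Move _ _ r2 r1] ++ uploop 32.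

(** Undefined values are comparable to nothing, so [ole x y] also asserts that both sides are
    defined. *)
Definition ole (disp : Order.disp_t) (U : orderType disp) (x y : option U) : bool :=
  if x is Some u then if y is Some v then (u <= v)%O else false else false.

Section Ole.

Variables (disp : Order.disp_t) (U : orderType disp).
Implicit Types x y z : option U.

Lemma ole_refl x : x -> ole x x.
Proof. by case: x => //= u _; exact: Order.POrderTheory.lexx. Qed.

Lemma ole_trans y x z : ole x y -> ole y z -> ole x z.
Proof. by case: x y z => [u|] [v|] [w|] //=; exact: Order.POrderTheory.le_trans. Qed.

Lemma ole_total x y : x -> y -> ~~ ole x y -> ole y x.
Proof.
case: x y => [u|] [v|] //= _ _; rewrite -Order.TotalTheory.ltNge.
exact: Order.POrderTheory.ltW.
Qed.

End Ole.

Definition anc (P : nat -> nat) (x i : nat) : Prop := exists t, x = iter t P i.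

Lemma anc_refl P x : anc P x x. Proof. by exists 0. Qed.

Lemma anc_up P x i : anc P x i -> anc P (P x) i.
Proof. by case=> t ->; exists t.+1. Qed.

Lemma anc_cases P x i : anc P x i -> x = i \/ anc P x (P i).
Proof. by case=> -[|t] ->; [left | right; exists t; rewrite iterSr]. Qed.

Lemma anc_trans P y x i : anc P x y -> anc P y i -> anc P x i.
Proof. by case=> t -> [t' ->]; exists (t + t'); rewrite iterD. Qed.

Lemma anc0 P x : P 0 = 0 -> anc P x 0 -> x = 0.
Proof. by move=> P0 [t ->]; elim: t => //= t ->. Qed.

(** * Subtree minima *)

Section Minima.

Variables (disp : Order.disp_t) (U : orderType disp).
Variables (m : nat) (P : nat -> nat) (V : nat -> option U).

(** A local condition at [i]; together with [valid], holding it everywhere makes [B i] a minimum of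
    the subtree of [i]. *)
Definition good (B : nat -> nat) (i : nat) : Prop :=
  ole (V (B i)) (V i) /\
  forall j, 0 < j <= m -> P j = i -> ole (V (B i)) (V (B j)).

(* The state while the new, smaller key of [p] is being propagated. *)
Definition almost (p : nat) (B : nat -> nat) (i : nat) : Prop :=
  (ole (V (B i)) (V i) \/ ole (V p) (V i)) /\
  forall j, 0 < j <= m -> P j = i ->
    ole (V (B i)) (V (B j)) \/ ole (V p) (V (B j)).

Definition valid (B : nat -> nat) : Prop :=
  forall i, 0 < i <= m -> 0 < B i <= m /\ anc P i (B i).

(** The invariant of both climbing loops: only [x] and its ancestors may still be wrong. At [x = 0]
    every element is good. *)
Definition good_off (B : nat -> nat) (x : nat) : Prop :=
  forall i, 0 < i <= m -> ~ anc P i x -> good B i.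

Hypothesis lt_P : forall i, 0 < i <= m -> P i < i.
Hypothesis V_def : forall i, 0 < i <= m -> V i.

(** Goodness of [i] involves [B] only at [i] and its children, so a change at [x] affects only [x],
    which is good by assumption, and [P x], which is again exempt. *)
Lemma good_offP B B' x : 0 < x <= m -> good_off B x -> good B' x ->
  (forall i, i != x -> B' i = B i) -> good_off B' (P x).
Proof.
move=> xm off gx e i im nai; have [->//|ix] := eqVneq i x.
have [] := off i im.
  by case/anc_cases => // /eqP; rewrite (negPf ix).
move=> g1 g2; split; first by rewrite e.
move=> j jm Pj; rewrite !e //; first exact: g2.
by apply/eqP => jx; apply: nai; rewrite -Pj jx; exact: anc_refl.
Qed.

(** By totality [V (B x)] is at most [V p], which absorbs the second alternatives of [almost]: node
    [x] is already good. *)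
Lemma step_keep p B x : 0 < x <= m -> 0 < p <= m -> valid B -> good_off B x ->
  almost p B x -> ~~ ole (V p) (V (B x)) -> good_off B (P x).
Proof.
move=> xm pm vB off [a1 a2] npB; apply: good_offP off _ _ => //.
have Bp : ole (V (B x)) (V p).
  by apply: ole_total npB; apply: V_def => //; case: (vB x xm).
by split=> [|j jm Pj]; [case: a1 | case: (a2 j jm Pj)] => // /(ole_trans Bp).
Qed.

(** [V p] lies below the old minimum, so both alternatives of [almost] put it below everything that
    [x] must dominate. At the parent of [x] the lowered minimum is [V p] itself, which [almost]
    tolerates. *)
Lemma step_set p B x : 0 < x <= m -> 0 < p <= m -> valid B -> good_off B x ->
  (forall i, 0 < i <= m -> almost p B i) -> anc P x p ->
  ole (V p) (V (B x)) ->
  let B' := set_at B x p in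
  [/\ valid B', good_off B' (P x) & forall i, 0 < i <= m -> almost p B' i].
Proof.
move=> xm pm vB off al xp pB B'.
have Px := lt_P xm; have [a1 a2] := al x xm.
have le1 : ole (V p) (V x) by case: a1 => // /(ole_trans pB).
have le2 j : 0 < j <= m -> P j = x -> ole (V p) (V (B j)).
  by move=> jm /(a2 j jm) [] // /(ole_trans pB).
split.
- move=> i im; have [->|ix] := eqVneq i x; first by rewrite /B' set_at_eq.
  by rewrite /B' set_at_neq //; exact: vB.
- apply: good_offP off _ _ => // [|i ix]; last by rewrite /B' set_at_neq.
  split; rewrite /B' set_at_eq // => j jm Pj.
  rewrite set_at_neq; first exact: le2.
  by apply/eqP => jx; move: Pj Px; rewrite jx => ->; rewrite ltnn.
- move=> i im; split.
    have [->|ix] := eqVneq i x; first by right.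
    by rewrite /B' set_at_neq //; case: (al i im).
  move=> j jm Pj; have [jx|jx] := eqVneq j x.
    by right; rewrite jx /B' set_at_eq ole_refl ?V_def.
  rewrite /B' (set_at_neq _ _ jx); have [ix|ix] := eqVneq i x.
    by right; apply: le2; rewrite // -ix.
  by rewrite set_at_neq //; case: (al i im) => _; apply.
Qed.

End Minima.

(** * Representation in memory *)

Section Heap.

Variables (disp : Order.disp_t) (U : orderType disp).
Implicit Types (h : memory 0 7 U) (X : seq addr).

Fixpoint chain h (p : pointer) (s : seq addr) : Prop :=
  if s is a :: s' then p = Some a /\ chain h (fld h sib a) s' else p = None.

Lemma eq_chain h h' p s : {in s, fld h' sib =1 fld h sib} ->
  chain h p s -> chain h' p s.
Proof.
elim: s p => //= a s IH p e [-> c]; split=> //.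
rewrite e ?mem_head //; apply: IH c => x xs.
by apply: e; rewrite in_cons xs orbT.
Qed.

(** [X] lists addresses by position, the header first. The [best] links and the keys are left out,
    so that key operations preserve [shape]. *)
Record shape h X (m : nat) (P K u : nat -> nat) : Prop := Shape {
  sh_size : size X = m.+1;
  sh_uniq : uniq X;
  sh_0 : nth 0 X 0 = 0;
  sh_lt : {in X, forall a, a < size h};
  sh_lay : layout m P K u;
  sh_par0 : fld h par 0 = None;
  sh_par : forall i, 0 < i <= m -> fld h par (nth 0 X i) = Some (nth 0 X (P i));
  sh_last : fld h prv 0 = if 0 < m then Some (nth 0 X m) else None;
  sh_prv : forall i, 0 < i <= m -> fld h prv (nth 0 X i) = Some (nth 0 X i.-1);
  sh_cur : forall i, 0 < i <= m ->
    fld h cur (nth 0 X i) = Some (nth 0 X (i - u i));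
  sh_lvl : forall i, 0 < i <= m -> fld h lvl (nth 0 X i) =
    if K i is k.+1 then Some (nth 0 X (sp k)) else None;
  sh_fc : fld h fc 0 = if 0 < m then Some (nth 0 X 1) else None;
  sh_kids : forall i, 0 < i <= m ->
    chain h (fld h fc (nth 0 X i)) [seq nth 0 X j | j <- kids P m i] }.

Definition bests h X m (B : nat -> nat) : Prop :=
  forall i, 0 < i <= m -> fld h best (nth 0 X i) = Some (nth 0 X (B i)).

Lemma eq_shape h h' X m P K u :
  (forall j a, j != best -> fld h' j a = fld h j a) -> size h <= size h' ->
  shape h X m P K u -> shape h' X m P K u.
Proof.
move=> e sz [? ? ? lt lay p0 p l pr c lv f ks]; split=> //; rewrite ?e //.
- by move=> a /lt; move/leq_trans; apply.
- by move=> i im; rewrite e // p.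
- by move=> i im; rewrite e // pr.
- by move=> i im; rewrite e // c.
- by move=> i im; rewrite e // lv.
- by move=> i im; rewrite e //; apply: eq_chain (ks i im) => a _; rewrite e.
Qed.

Lemma set_nth_head (T : Type) (x0 y : T) s : set_nth x0 s 0 y = y :: behead s.
Proof. by case: s. Qed.

(** * Restoring the minima on the way to the root *)

Section Walk.

Variables (X : seq addr) (m : nat) (P K u : nat -> nat).
Local Notation ad i := (nth 0 X i).

Definition vals h i : option U := val h (ad i).

Lemma shape_lt h i : shape h X m P K u -> i <= m -> ad i < size h.
Proof.
move=> sh im; apply: (sh_lt sh); apply: mem_nth; rewrite (sh_size sh) ltnS.
by [].
Qed.

Lemma ad_eq h i j : shape h X m P K u -> i <= m -> j <= m ->
  (ad i == ad j) = (i == j).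
Proof. by move=> sh im jm; rewrite nth_uniq ?(sh_size sh) ?(sh_uniq sh). Qed.

Lemma ad_eq0 h i : shape h X m P K u -> i <= m ->
  (Some (ad i) == Some 0) = (i == 0).
Proof. by move=> sh im; rewrite -(ad_eq sh) // (sh_0 sh). Qed.

Lemma bests_upd h B x p : shape h X m P K u -> bests h X m B -> x <= m ->
  bests (upd h (ad x) best (Some (ad p))) X m (set_at B x p).
Proof.
move=> sh hB xm i im; rewrite fld_upd ?(shape_lt sh) // (ad_eq sh) //; last lia.
by have [->|ix] := eqVneq i x; rewrite ?set_at_eq ?set_at_neq //= hB.
Qed.

Lemma shape_upd h x q : shape h X m P K u -> x <= m ->
  shape (upd h (ad x) best q) X m P K u.
Proof.
move=> sh xm; have xh := shape_lt sh xm.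
apply: eq_shape sh; last by rewrite size_upd.
by move=> j a jb; rewrite fld_upd // (negPf jb) andbF.
Qed.

Definition repaired h (h' : memory 0 7 U) : Prop :=
  exists B, [/\ shape h' X m P K u, bests h' X m B, valid m P B &
    (forall i, 0 < i <= m -> good m P (vals h') B i) /\ val h' =1 val h].

(** Induction on [n], at seven instructions per round. The offset [o] lets DecreaseKey and Push
    share the loop. *)
Lemma halts_uploop prog o n x p s h B :
  (forall i, onth prog (o + i) = onth (uploop o) i) ->
  shape h X m P K u -> bests h X m B -> (forall i, 0 < i <= m -> vals h i) ->
  0 < p <= m -> x <= m -> iter n P x = 0 -> anc P x p -> valid m P B ->
  (forall i, 0 < i <= m -> almost m P (vals h) p B i) ->
  good_off m P (vals h) B x ->
  halts prog (7 * n + 2)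
    (Config o (rf [:: Some 0, Some (ad p), Some (ad x) & s]) h)
    (fun q h' => q = Some (ad p) /\ repaired h h').
Proof.
move=> progE; elim: n x s h B => [|n IH] x s h B sh hB hV pm xm nx xp vB al off.
  move: nx off => /= -> off; rewrite muln0 -[o]addn0.
  apply: (halts_ifeq (progE 0)); rewrite /= (sh_0 sh) eqxx.
  apply: (halts_halt _ (progE 7)); split=> //.
  exists B; split=> //; split=> // i im; apply: off => // /anc0.
  by rewrite (lay_P0 (sh_lay sh)) => /(_ erefl); lia.
have -> : 7 * n.+1 + 2 = (7 * n + 2).+4.+3 by lia.
rewrite -[o]addn0; apply: (halts_ifeq (progE 0)).
rewrite /= (ad_eq0 sh) //.
(* [n] only bounds the distance, so the header may be reached early. *)
have [x0|x0] := eqVneq x 0.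
  apply: (halts_halt _ (progE 7)); split=> //.
  exists B; split=> //; split=> // i im; apply: off => //; rewrite x0 => /anc0.
  by rewrite (lay_P0 (sh_lay sh)) => /(_ erefl); lia.
have xm' : 0 < x <= m by lia.
have xh := shape_lt sh xm.
have lt_P := lay_P (sh_lay sh).
rewrite -(addnS o); apply: (halts_follow (progE 1)); [by [] | exact: xh |].
rewrite /= hB //.
rewrite set_nth_head -(addnS o); set s' := _ :: behead s.
have [Bm aB] := vB x xm'.
have := hV p pm; have := hV _ Bm; rewrite /vals.
case vBx: val => [w|//] _; case vp: val => [v|//] _.
apply: (halts_ifle (progE 2)); [by [] | by [] | exact: vp | exact: vBx |].
have oleE : ole (vals h p) (vals h (B x)) = (v <= w)%O by rewrite /vals vp vBx.
have PxE : iter n P (P x) = 0 by rewrite -iterSr.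
have Pxm : P x <= m by have := lt_P x xm'; lia.
case: ifP => vw; last first.
  rewrite -(addnS o); apply: (halts_jump (progE 3)).
  apply: (halts_follow (progE 5)); [by [] | exact: xh |].
  rewrite /= (sh_par sh) // -(addnS o).
  apply: (halts_jump (progE 6)); apply: (@halts_le _ _ _ (7 * n + 2)); first lia.
  apply: (IH _ _ _ B) => //; first exact: anc_up.
  by apply: (step_keep hV xm' pm vB off (al x xm')); rewrite oleE vw.
apply: (halts_setptr (progE 4)); [by [] | exact: xh |]; rewrite /= -(addnS o).
set h1 := upd _ _ _ _.
have sh1 : shape h1 X m P K u by exact: shape_upd.
have xh1 := shape_lt sh1 xm.
have V1 : val h1 =1 val h by move=> a; rewrite val_upd.
have Vs1 : vals h1 = vals h.
  by apply: functional_extensionality => i; rewrite /vals V1.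
apply: (halts_follow (progE 5)); [by [] | exact: xh1 |].
rewrite /= (sh_par sh1) // -(addnS o).
apply: (halts_jump (progE 6)).
have [|vB' off' al'] := step_set lt_P hV xm' pm vB off al xp.
  by rewrite oleE.
have [] := IH (P x) s' h1 (set_at B x p).
all: rewrite ?Vs1 //; try exact: anc_up; try exact: bests_upd.
move=> q [h' [e [qE [B2 [g1 g2 g3 [g4 g5]]]]]]; exists q, h'.
split; first by apply: run_le e; lia.
by split=> //; exists B2; split=> //; split=> // a; rewrite g5 V1.
Qed.

(** Continuation form: [t] is the time for what follows the scan, which may assume that the final
    candidate [b'] is at most the initial one and all the children's minima. *)
Lemma halts_scan t ra rb rc b js y z h B Q :
  shape h X m P K u -> bests h X m B -> (forall i, 0 < i <= m -> vals h i) ->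
  valid m P B ->
  chain h y [seq ad j | j <- js] -> {in js, forall j, 0 < j <= m} -> 0 < b <= m ->
  (forall b' z', b' = b \/ (exists2 j, j \in js & b' = B j) ->
    ole (vals h b') (vals h b) ->
    {in js, forall j, ole (vals h b') (vals h (B j))} ->
    halts change_prog t
      (Config 12 (rf [:: ra; rb; rc; Some (ad b'); None; z'; None; None]) h) Q) ->
  halts change_prog (7 * size js + 1 + t)
    (Config 5 (rf [:: ra; rb; rc; Some (ad b); y; z; None; None]) h) Q.
Proof.
move=> sh hB hV vB; elim: js b y z => [|j js IH] b y z.
  move=> /= -> _ bm Qb; apply: (@halts_ifeq _ _ change_prog); first by [].
  by apply: Qb => //; [left | exact: ole_refl (hV _ bm)].
move=> [-> ch] jsm bm Qb.
have jm : 0 < j <= m by apply: jsm; rewrite mem_head.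
have jsm' : {in js, forall j, 0 < j <= m}.
  by move=> i ijs; apply: jsm; rewrite in_cons ijs orbT.
have [Bm _] := vB j jm; have jh : ad j < size h by apply: (shape_lt sh); lia.
have -> : 7 * size (j :: js) + 1 + t = (7 * size js + 1 + t).+4.+3 by rewrite /=; lia.
apply: (@halts_ifeq _ _ change_prog); first by [].
apply: (@halts_follow _ _ change_prog); [by [] | by [] | exact: jh |].
rewrite /= hB //.
have := hV _ Bm; have := hV _ bm; rewrite {1 2}/vals.
case vb: val => [w|//] _; case vBj: val => [v|//] _.
apply: (@halts_ifle _ _ change_prog);
  [by [] | by [] | by [] | exact: vBj | exact: vb |].
have oleE : ole (vals h (B j)) (vals h b) = (v <= w)%O by rewrite /vals vb vBj.
pose b1 := if (v <= w)%O then B j else b.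
have b1m : 0 < b1 <= m by rewrite /b1; case: ifP.
have b1b : ole (vals h b1) (vals h b).
  by rewrite /b1; case: ifP; rewrite ?oleE // => _; exact: ole_refl (hV _ bm).
have b1B : ole (vals h b1) (vals h (B j)).
  rewrite /b1; case: ifP => vw; first exact: ole_refl (hV _ Bm).
  by apply: ole_total; rewrite ?oleE ?vw //; exact: hV.
have next : halts change_prog (7 * size js + 1 + t).+2
    (Config 10 (rf [:: ra; rb; rc; Some (ad b1); Some (ad j); Some (ad (B j));
                       None; None]) h) Q.
  apply: (@halts_follow _ _ change_prog); [by [] | by [] | exact: jh |].
  apply: (@halts_jump _ _ change_prog); first by [].
  apply: IH => // b' z' b'E b'b b'js; apply: Qb.
  - case: b'E => [->|[i ijs ->]]; last first.
      by right; exists i; rewrite // in_cons ijs orbT.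
    by rewrite /b1; case: ifP => _; [right; exists j; rewrite ?mem_head | left].
  - exact: ole_trans b1b.
  - move=> i; rewrite in_cons => /predU1P[->|]; last exact: b'js.
    exact: ole_trans b1B.
move: next; rewrite /b1; case: ifP => vw next.
  apply: (@halts_move _ _ change_prog); first by [].
  by apply: halts_le next; lia.
apply: (@halts_jump _ _ change_prog); first by [].
by apply: halts_le next; lia.
Qed.

(** Node [x] has at most [x - P x + 1] children, so its round costs at most [7 * (x - P x) + 14],
    which is at most [21 * (x - P x)]; these bounds telescope along the path. *)
Lemma halts_repair p x b y z h B :
  shape h X m P K u -> bests h X m B -> (forall i, 0 < i <= m -> vals h i) ->
  x <= m -> valid m P B -> good_off m P (vals h) B x ->
  halts change_prog (21 * x + 2)
    (Config 2 (rf [:: Some 0; Some (ad p); Some (ad x); b; y; z; None; None]) h)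
    (fun q h' => q = Some (ad p) /\ repaired h h').
Proof.
elim/ltn_ind: x b y z h B => x IH b y z h B sh hB hV xm vB off.
have [x0|x0] := eqVneq x 0.
  rewrite x0 (sh_0 sh) muln0; apply: (@halts_ifeq _ _ change_prog); first by [].
  apply: halts_halt; first by [].
  split=> //; exists B; split=> //; split=> // i im; apply: off => //.
  by rewrite x0 => /anc0; rewrite (lay_P0 (sh_lay sh)) => /(_ erefl); lia.
have xm' : 0 < x <= m by lia.
have xh := shape_lt sh xm.
have lt_P := lay_P (sh_lay sh); have Px := lt_P x xm'.
apply: (@halts_le _ _ _
  (7 * size (kids P m x) + 1 + (21 * P x + 2).+3).+3).
  have := lay_kids (sh_lay sh) xm'; have := lay_u (sh_lay sh) xm'; lia.
apply: (@halts_ifeq _ _ change_prog); first by [].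
rewrite /= (ad_eq0 sh) // (negPf x0).
apply: (@halts_move _ _ change_prog); first by [].
apply: (@halts_follow _ _ change_prog); [by [] | by [] | exact: xh |].
refine (halts_scan _ sh hB hV vB (sh_kids sh xm') _ xm' _).
  by move=> j; rewrite mem_kids => /andP[].
move=> b' z' b'E b'x b'js.
have b'm : 0 < b' <= m /\ anc P x b'.
  case: b'E => [->|[j]]; first by split=> //; exact: anc_refl.
  rewrite mem_kids => /andP[jm /eqP <-] ->; have [Bm aB] := vB j jm.
  by split=> //; exact: anc_up.
apply: (@halts_setptr _ _ change_prog); [by [] | by [] | exact: xh |].
set h1 := upd _ _ _ _.
have sh1 : shape h1 X m P K u by exact: shape_upd.
have xh1 := shape_lt sh1 xm.
have V1 : val h1 =1 val h by move=> a; rewrite val_upd.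
have Vs1 : vals h1 = vals h.
  by apply: functional_extensionality => i; rewrite /vals V1.
apply: (@halts_follow _ _ change_prog); [by [] | by [] | exact: xh1 |].
rewrite /= (sh_par sh1) //.
apply: (@halts_jump _ _ change_prog); first by [].
have [||||||q [h' [e [qE [B2 [g1 g2 g3 [g4 g5]]]]]]] :=
  IH (P x) Px (Some (ad b')) None z' h1 (set_at B x b').
all: rewrite ?Vs1 //; try exact: bests_upd; try lia.
- move=> i im; have [->|ix] := eqVneq i x; first by rewrite set_at_eq.
  by rewrite set_at_neq //; exact: vB.
- apply: good_offP off _ _ => // [|i ix]; last by rewrite set_at_neq.
  split; rewrite set_at_eq // => j jm Pj.
  rewrite set_at_neq; first by apply: b'js; rewrite mem_kids jm Pj eqxx.
  by apply/eqP => jx; move: Pj Px; rewrite jx => ->; rewrite ltnn.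
exists q, h'; split; first by apply: run_le e.
by split=> //; exists B2; split=> //; split=> // a; rewrite g5 V1.
Qed.

End Walk.

(** * Linking a new last element into the tree *)

Section Append.

Variables (X : seq addr) (m : nat) (P K u : nat -> nat) (x c k : nat).
Variable u' : nat -> nat.
Local Notation ad i := (nth 0 X i).
Local Notation X' := (rcons X x).
Local Notation P' := (set_at P m.+1 c).
Local Notation K' := (set_at K m.+1 k).

Hypothesis lay' : layout m.+1 P' K' u'.
Hypothesis cm : c <= m.
Hypothesis c_gt0 : 0 < m -> 0 < c.
Hypothesis u'E : forall i, 0 < i <= m -> i != c -> u' i = u i.
Hypothesis xX : x \notin X.

Lemma nth_X' h i : shape h X m P K u -> i <= m -> nth 0 X' i = ad i.
Proof. by move=> sh im; rewrite nth_rcons (sh_size sh) ltnS im. Qed.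

Lemma nth_X'_last h : shape h X m P K u -> nth 0 X' m.+1 = x.
Proof. by move=> sh; rewrite nth_rcons (sh_size sh) ltnn eqxx. Qed.

Lemma ad_neq h i : shape h X m P K u -> i <= m -> (ad i == x) = false.
Proof.
move=> sh im; apply/negP => /eqP e; move: xX; rewrite -e mem_nth //.
by rewrite (sh_size sh) ltnS.
Qed.

(** Treats both kinds of new nodes at once; they differ only in [lvl], [cur] and the counters. Old
    child chains survive because no old [sib] link changes. *)
Lemma shape_append h h' : shape h X m P K u ->
  x < size h' -> size h <= size h' -> fld h fc x = None ->
  (forall a, fld h' par a = if a == x then Some (ad c) else fld h par a) ->
  (forall a, fld h' prv a = if a == x then Some (ad m) else
     if a == 0 then Some x else fld h prv a) ->
  (forall a, fld h' fc a = if a == ad c then Some x else fld h fc a) ->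
  (forall a, fld h' sib a = if a == x then fld h fc (ad c) else fld h sib a) ->
  (forall a, a != x -> fld h' lvl a = fld h lvl a) ->
  fld h' lvl x = (if k is l.+1 then Some (nth 0 X' (sp l)) else None) ->
  (forall a, a != x -> a != ad c -> fld h' cur a = fld h cur a) ->
  fld h' cur x = Some (nth 0 X' (m.+1 - u' m.+1)) ->
  (0 < c -> fld h' cur (ad c) = Some (ad (c - u' c))) ->
  shape h' X' m.+1 P' K' u'.
Proof.
move=> sh xh' hh' fcx parE prvE fcE sibE lvlE lvlx curE curx curc.
have nX i := @nth_X' h i sh; have nXl := nth_X'_last sh.
have nx i := @ad_neq h i sh.
have n0 : (0 == x) = false by rewrite -(sh_0 sh) nx.
have nz i : i <= m -> (ad i == 0) = (i == 0).
  by move=> im; rewrite -[RHS](ad_eq sh) // (sh_0 sh).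
have lt_P := lay_P (sh_lay sh).
have nc i : i <= m -> (ad i == ad c) = (i == c) by move=> im; rewrite (ad_eq sh).
have splt i : 0 < i <= m.+1 -> i = m.+1 \/ 0 < i <= m by lia.
split=> //.
- by rewrite size_rcons (sh_size sh).
- by rewrite rcons_uniq xX (sh_uniq sh).
- by rewrite nX // (sh_0 sh).
- move=> a; rewrite mem_rcons in_cons => /predU1P[-> //|/(sh_lt sh) lt].
  exact: leq_trans hh'.
- by rewrite parE n0 (sh_par0 sh).
- move=> i /splt[->|im]; first by rewrite nXl parE eqxx set_at_eq nX.
  rewrite set_at_neq; last lia.
  have Pi := lt_P i im.
  by rewrite !nX ?parE ?nx ?(sh_par sh) //; lia.
- by rewrite prvE n0 eqxx nXl.
- move=> i /splt[->|im]; first by rewrite nXl prvE eqxx nX.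
  rewrite !nX; try lia.
  by rewrite prvE nx ?nz ?ifN ?(sh_prv sh) //; lia.
- move=> i /splt[->|im]; first by rewrite nXl curx.
  rewrite !nX; try lia.
  have [ic|ic] := eqVneq i c; first by rewrite ic curc //; lia.
  by rewrite curE ?u'E ?(sh_cur sh) ?nx ?nc //; lia.
- move=> i /splt[->|im]; first by rewrite nXl lvlx set_at_eq.
  rewrite nX; last lia.
  rewrite set_at_neq ?lvlE ?(sh_lvl sh) ?nx //; try lia.
  have := lay_sp_le (sh_lay sh) im; case: (K i) => // l /= li.
  by rewrite nX //; lia.
- rewrite fcE -{1}(sh_0 sh) (ad_eq sh) // (sh_fc sh).
  case: (posnP m) => [m0|m0].
    by have -> : c = 0 by [lia]; move: nXl; rewrite m0 eqxx /= => ->.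
  by rewrite nX // ltn_eqF ?c_gt0.
have chainE s p : {in s, forall j, j <= m} ->
    chain h p [seq ad j | j <- s] -> chain h' p [seq nth 0 X' j | j <- s].
  move=> sm; have -> : [seq nth 0 X' j | j <- s] = [seq ad j | j <- s].
    by apply/eq_in_map => j /sm; apply: nX.
  apply: eq_chain => a /mapP[j /sm jm ->].
  by rewrite sibE nx.
have kidsE i : {in kids P m i, forall j, j <= m}.
  by move=> j; rewrite mem_kids => /andP[/andP[]].
move=> i /splt[->|im].
  rewrite nXl kids_set_at ifN; last lia.
  rewrite kids_nil //= fcE; case: eqP => // xc.
  by move: (nx c cm); rewrite -xc eqxx.
rewrite nX; last lia.
rewrite kids_set_at fcE nc 1?eq_sym; last lia.
case: eqP => [ci|_]; last exact: chainE (sh_kids sh im).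
by rewrite /= nXl sibE eqxx ci; split=> //; exact: chainE (sh_kids sh im).
Qed.

(** [h1] is [h] after the writes to [lvl] and [cur]; from there on, both kinds of insertion run the
    same code. *)
Lemma halts_link h h1 B a b l T :
  shape h X m P K u -> bests h X m B -> valid m P B ->
  (forall i, 0 < i <= m -> good m P (vals X h) B i) ->
  (forall i, 0 < i <= m -> vals X h i) ->
  val h x -> fld h fc x = None ->
  size h1 = size h -> val h1 =1 val h ->
  (forall j a, j != lvl -> j != cur -> fld h1 j a = fld h j a) ->
  (forall a, a != x -> fld h1 lvl a = fld h lvl a) ->
  fld h1 lvl x = (if k is l.+1 then Some (nth 0 X' (sp l)) else None) ->
  (forall a, a != x -> a != ad c -> fld h1 cur a = fld h cur a) ->
  fld h1 cur x = Some (nth 0 X' (m.+1 - u' m.+1)) ->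
  (0 < c -> fld h1 cur (ad c) = Some (ad (c - u' c))) ->
  14 * m + 31 <= T ->
  halts push_prog T
    (Config 24 (rf [:: Some 0; Some x; Some (ad c); Some (ad m); a; b; l; None]) h1)
    (fun q h' => q = Some x /\ repaired X' m.+1 P' K' u' h h').
Proof.
move=> sh hB vB gB hV hx fcx sz V1 f1 lvlE lvlx curE curx curc TE.
have xh1 : x < size h1 by rewrite sz; exact: val_lt.
have ch1 : ad c < size h1 by rewrite sz; exact: shape_lt sh _.
have z1 : 0 < size h1 by exact: leq_ltn_trans (leq0n _) xh1.
have [n [j [nE nK ji]]] := lay_depth lay' (leqnn m.+1).
(* Here [j <= sp j <= m.+1], so [n] is at most [2 * m + 3]; a linear bound on the depth is enough
   for Push. *)
have := leq_sp j => jsp.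
apply: (@halts_le _ _ _ (7 * n + 2).+4.+4); first lia.
do 3![apply: (@halts_setptr _ _ push_prog);
  [by [] | by [] | by do ?apply: lt_upd |]].
apply: (@halts_follow _ _ push_prog); [by [] | by [] | by do ?apply: lt_upd |].
do 3![apply: (@halts_setptr _ _ push_prog);
  [by [] | by [] | by do ?apply: lt_upd |]].
apply: (@halts_move _ _ push_prog); first by [].
rewrite /=; set h2 := upd _ _ best _.
have fE i d : fld h2 i d = if i == best then if d == x then Some x else fld h1 i d else
    if i == fc then if d == ad c then Some x else fld h1 i d else
    if i == sib then if d == x then fld h1 fc (ad c) else fld h1 i d else
    if i == prv then if d == 0 then Some x else
      if d == x then Some (ad m) else fld h1 i d else
    if i == par then if d == x then Some (ad c) else fld h1 i d else fld h1 i d.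
  rewrite /h2 !fld_upd; try by do ?apply: lt_upd.
  rewrite !andbF.
  case: i => -[|[|[|[|[|[|[|//]]]]]]] i7; rewrite ?andbF ?andbT //=.
have V2 : val h2 =1 val h by move=> d; rewrite /h2 !val_upd ?V1 //; do ?apply: lt_upd.
have sz2 : size h2 = size h by rewrite /h2 !size_upd //; do ?apply: lt_upd.
have nX i := @nth_X' h i sh; have nXl := nth_X'_last sh.
have nx i := @ad_neq h i sh.
have n0 : (0 == x) = false by rewrite -(sh_0 sh) nx.
have splt i : 0 < i <= m.+1 -> i = m.+1 \/ 0 < i <= m by lia.
have sh2 : shape h2 X' m.+1 P' K' u'.
  apply: (shape_append sh); rewrite ?sz2 -?sz //.
  - by move=> d; rewrite fE /= f1.
  - move=> d; rewrite fE /= f1 //; case: (eqVneq d x) => [->|//].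
    by rewrite eq_sym n0.
  - by move=> d; rewrite fE /= f1.
  - by move=> d; rewrite fE /= !f1.
  - by move=> d dx; rewrite fE /= lvlE.
  - by rewrite fE.
  - by move=> d dx dc; rewrite fE /= curE.
  - by rewrite fE.
  - by move=> c0; rewrite fE /= curc.
have lt_P' := lay_P lay'.
have W i : 0 < i <= m -> vals X' h2 i = vals X h i.
  by move=> im; rewrite /vals nX ?V2 //; lia.
have Wl : vals X' h2 m.+1 = val h x by rewrite /vals nXl V2.
pose B2 := set_at B m.+1 m.+1.
have B2E i : 0 < i <= m -> B2 i = B i by move=> im; rewrite /B2 set_at_neq //; lia.
have lm : 0 < m.+1 <= m.+1 by rewrite leqnn.
have B2l : B2 m.+1 = m.+1 by rewrite /B2 set_at_eq.
have ancP i d : d <= m -> anc P i d -> anc P' i d.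
  by move=> dm [t ->]; exists t; rewrite (iter_set_at (sh_lay sh)).
have hB2 : bests h2 X' m.+1 B2.
  move=> i /splt[->|im]; first by rewrite B2l nXl fE /= eqxx.
  have [Bm _] := vB i im.
  by rewrite B2E // !nX ?fE /= ?nx ?f1 ?hB //; lia.
have hV2 i : 0 < i <= m.+1 -> vals X' h2 i.
  by move=> /splt[->|im]; [rewrite Wl | rewrite W //; exact: hV].
have vB2 : valid m.+1 P' B2.
  move=> i /splt[->|im]; first by rewrite B2l leqnn; split=> //; exact: anc_refl.
  by have [Bm aB] := vB i im; rewrite B2E //; split; [lia | apply: ancP => //; lia].
have WB i : 0 < i <= m -> vals X' h2 (B2 i) = vals X h (B i).
  by move=> im; rewrite B2E // W //; case: (vB i im).
have PE i : 0 < i <= m -> P' i = P i by move=> im; rewrite set_at_neq //; lia.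
have fresh d : 0 < d <= m.+1 -> P' d != m.+1 by move=> dm; have := lt_P' d dm; lia.
(* Appending acts like decreasing the key of [m.+1]: among the old nodes only its parent can violate
   a condition, and only against the new key. *)
have al i : 0 < i <= m.+1 -> almost m.+1 P' (vals X' h2) m.+1 B2 i.
  move=> /splt[->|im]; split.
  - by right; apply/ole_refl/hV2.
  - by move=> d /fresh/eqP fd /fd.
  - by left; rewrite WB // W //; case: (gB i im).
  move=> d /splt[->|dm]; first by right; rewrite B2l ole_refl ?hV2.
  by rewrite PE // => Pd; left; rewrite !WB //; case: (gB i im) => _; apply.
have off : good_off m.+1 P' (vals X' h2) B2 m.+1.
  move=> i /splt[->|im] nai; first by case: nai; exact: anc_refl.
  split; first by rewrite WB // W //; case: (gB i im).
  move=> d /splt[->|dm] Pd; first by case: nai; rewrite -Pd; exact/anc_up/anc_refl.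
  by rewrite !WB //; case: (gB i im) => _; apply=> //; rewrite -Pd PE.
have loopE i : onth push_prog (32 + i) = onth (uploop 32) i by [].
have := halts_uploop [:: Some (ad m); fld h1 fc (ad c); b; l; None] loopE
  sh2 hB2 hV2 lm (leqnn m.+1) nE (anc_refl P' m.+1) vB2 al off.
rewrite nXl => -[q [h' [e [qE [B3 [g1 g2 g3 [g4 g5]]]]]]].
exists q, h'; split; last first.
  by split=> //; exists B3; split=> //; split=> // d; rewrite g5 V2.
rewrite -e; congr (run _ _ (Config _ (rf _) _)).
rewrite !fld_upd; try by do ?apply: lt_upd.
by rewrite /= !andbF.
Qed.

End Append.

(** * Finding the parent of a new element *)

Section Push.

Variables (X : seq addr) (m : nat) (P K u : nat -> nat) (x : addr).
Variables (h : memory 0 7 U) (B : nat -> nat).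
Local Notation ad i := (nth 0 X i).

Hypothesis sh : shape h X m P K u.
Hypothesis hB : bests h X m B.
Hypothesis vB : valid m P B.
Hypothesis gB : forall i, 0 < i <= m -> good m P (vals X h) B i.
Hypothesis hV : forall i, 0 < i <= m -> vals X h i.
Hypothesis hx : val h x.
Hypothesis xX : x \notin X.
Hypothesis fcx : fld h fc x = None.

Let lay := sh_lay sh.
Let xh : x < size h := val_lt hx.

Definition pushed (q : pointer) (h' : memory 0 7 U) : Prop :=
  q = Some x /\ exists P' K' u', repaired (rcons X x) m.+1 P' K' u' h h'.

Lemma halts_spine t j a b l :
  sp j = iter t P m -> K (sp j) = j.+1 -> m.+1 = sp j.+1 -> (0 < m -> 0 < sp j) ->
  halts push_prog (14 * m + 33)
    (Config 22 (rf [:: Some 0; Some x; Some (ad (sp j)); Some (ad m); a; b; l; None]) h)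
    pushed.
Proof.
move=> ct Kc mE c0; have lay' := layout_spine lay ct Kc mE.
have cm : sp j <= m by rewrite ct; exact: lay_iter_le lay _ _ _.
have cx := ad_neq xX sh cm.
have nXl := nth_X'_last x sh.
apply: (@halts_le _ _ _ (14 * m + 31).+2); first lia.
do 2![apply: (@halts_setptr _ _ push_prog);
  [by [] | by [] | by do ?apply: lt_upd |]].
have h1h : size (upd (upd h x lvl (Some x)) x cur (Some x)) = size h.
  by rewrite !size_upd //; do ?apply: lt_upd.
apply: (@halts_imp _ _ _ _ _ (fun q h' => q = Some x /\
  repaired (rcons X x) m.+1 _ _ _ h h')); last first.
  apply: (halts_link lay' cm c0 _ xX _ _ _ sh hB vB gB hV hx fcx h1h) => //.
  - by move=> i im _; rewrite set_at_neq //; lia.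
  - by move=> d; rewrite !val_upd //; do ?apply: lt_upd.
  - move=> i d il ic; rewrite !fld_upd ?(negPf il) ?(negPf ic) ?andbF //.
    by do ?apply: lt_upd.
  - by move=> d dx; rewrite !fld_upd ?(negPf dx) //; do ?apply: lt_upd.
  - by rewrite !fld_upd ?eqxx /= -?mE ?nXl //; do ?apply: lt_upd.
  - by move=> d dx _; rewrite !fld_upd ?(negPf dx) //; do ?apply: lt_upd.
  - by rewrite !fld_upd ?eqxx /= ?set_at_eq ?subn0 ?nXl //; do ?apply: lt_upd.
  move=> c1; rewrite !fld_upd ?cx /=; try by do ?apply: lt_upd.
  by rewrite set_at_neq ?(sh_cur sh) ?c1 //; lia.
by move=> q h' [-> re]; split=> //; do 3!eexists; exact: re.
Qed.

Lemma halts_child t c b y :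
  c = iter t P m -> 0 < c <= m -> m.+1 = c + tsize (K c) (u c) -> u c < c - P c ->
  halts push_prog (14 * m + 39)
    (Config 6 (rf [:: Some 0; Some x; Some (ad c); Some (ad m); Some (ad (c - u c));
      b; y; None]) h)
    pushed.
Proof.
move=> ct cm mE uc; have /= := layout_child lay ct cm mE uc.
set k := (K c).-1; set u' := set_at (set_at u c _) _ _ => lay'.
have K0 : K c = k.+1.
  rewrite prednK // lt0n; apply/eqP => K0.
  by have := lay_leaf lay cm K0; lia.
have cm' : c <= m by lia.
have ch := shape_lt sh cm'; have cx := ad_neq xX sh cm'.
have nXl := nth_X'_last x sh.
have spk : sp k <= m by have := lay_sp_le lay cm; rewrite K0 /=; lia.
have xc : (x == ad c) = false by rewrite eq_sym.
have nX := nth_X' x sh.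
apply: (@halts_le _ _ _ (14 * m + 31).+4.+4); first lia.
apply: (@halts_follow _ _ push_prog); [by [] | by [] | by apply: (shape_lt sh); lia |].
rewrite /= (sh_prv sh); last lia.
apply: (@halts_setptr _ _ push_prog); [by [] | by [] | exact: ch |].
apply: (@halts_follow _ _ push_prog); [by [] | by [] | exact: lt_upd |].
rewrite /= fld_upd // eqxx /= (sh_lvl sh) // K0.
apply: (@halts_follow _ _ push_prog);
  [by [] | by [] | by apply: lt_upd; exact: shape_lt sh _ |].
rewrite /= fld_upd // andbF.
set l := fld h par _.
(* The parent of the spine node encoding a level encodes the level below, by [lay_anchor]; the null
   parent of the header stands for level 0. *)
have lE : l = if k is k'.+1 then Some (ad (sp k')) else None.
  rewrite /l; case kE: k => [|k']; first by rewrite (sh_0 sh) (sh_par0 sh).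
  have spk0 : 0 < sp k by rewrite kE; have := leq_sp k'.+1; lia.
  rewrite -kE (sh_par sh) ?spk0 //; congr (Some (ad _)).
  by rewrite kE; apply: (lay_anchor lay (i := c)); rewrite // K0 kE.
apply: (@halts_setptr _ _ push_prog); [by [] | by [] | exact: lt_upd |].
apply: (@halts_ifeq _ _ push_prog); first by [].
rewrite /=.
set h2 := upd (upd _ _ _ _) _ _ _.
have h2x : x < size h2 by do 2!apply: lt_upd.
(* A leaf gets its parent as [cur], which marks it as full; other nodes start at themselves. *)
pose z := if k == 0 then Some (ad c) else Some x.
have uz : z = Some (nth 0 (rcons X x) (m.+1 - u' m.+1)).
  rewrite /z /u' set_at_eq; case: ifP => _; last by rewrite subn0 nXl.
  by rewrite subKn ?nX //; lia.
have link a' b' y' : halts push_prog (14 * m + 31)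
    (Config 24 (rf [:: Some 0; Some x; Some (ad c); Some (ad m); a'; b'; y'; None])
      (upd h2 x cur z)) pushed.
  apply: (@halts_imp _ _ _ _ _ (fun q h' => q = Some x /\
    repaired (rcons X x) m.+1 _ _ _ h h')); last first.
    apply: (halts_link lay' cm' _ _ xX a' b' y' sh hB vB gB hV hx fcx _) => //.
    - by lia.
    - by move=> i im ic; rewrite /u' set_at_neq ?set_at_neq //; lia.
    - by rewrite !size_upd //; do ?apply: lt_upd.
    - by move=> d; rewrite !val_upd //; do ?apply: lt_upd.
    - move=> i d il ic; rewrite !fld_upd ?(negPf il) ?(negPf ic) ?andbF //.
      by do ?apply: lt_upd.
    - by move=> d dx; rewrite !fld_upd ?(negPf dx) ?andbF //; do ?apply: lt_upd.
    - rewrite !fld_upd ?eqxx /= ?lE; try by do ?apply: lt_upd.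
      case kE: k => [|k'] //; rewrite nX //; apply: leq_trans spk.
      by rewrite kE; exact/ltnW/sp_ltS.
    - by move=> d dx dc; rewrite !fld_upd ?(negPf dx) ?(negPf dc) //; do ?apply: lt_upd.
    - by rewrite !fld_upd ?eqxx ?uz //; do ?apply: lt_upd.
    move=> c1; rewrite !fld_upd ?cx ?eqxx /=; try by do ?apply: lt_upd.
    rewrite /u' set_at_neq ?set_at_eq; last lia.
    by congr (Some (ad _)); lia.
  by move=> q h' [-> re]; split=> //; do 3!eexists; exact: re.
move: link; rewrite /z {1}lE; case: (k) => [|k'] /= link.
  apply: (@halts_setptr _ _ push_prog); [by [] | by [] | exact: h2x |].
  by apply: (@halts_jump _ _ push_prog).
apply: (@halts_setptr _ _ push_prog); [by [] | by [] | exact: h2x |].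
by apply: (@halts_jump _ _ push_prog).
Qed.

(** Each round takes seven instructions and lowers [c]; [lay_climb] carries the equation for [m.+1]
    over to the parent. *)
Lemma halts_climb t c a b y :
  c = iter t P m -> 0 < c <= m -> m.+1 = c + tsize (K c) (u c) ->
  halts push_prog (8 * c + 14 * m + 50)
    (Config 3 (rf [:: Some 0; Some x; Some (ad c); Some (ad m); a; b; y; None]) h)
    pushed.
Proof.
elim/ltn_ind: c t a b y => c IH t a b y ct cm mE.
have cm' : c <= m by lia.
have ch := shape_lt sh cm'; have Pc := lay_P lay cm.
have uc := lay_u lay cm.
apply: (@halts_le _ _ _ (8 * c + 14 * m + 47).+3); first lia.
apply: (@halts_follow _ _ push_prog); [by [] | by [] | exact: ch |].
rewrite /= (sh_cur sh) //.
apply: (@halts_follow _ _ push_prog); [by [] | by [] | exact: ch |].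
rewrite /= (sh_par sh) //.
apply: (@halts_ifeq _ _ push_prog); first by [].
rewrite [_ == _](ad_eq sh) /=; [|lia|lia].
case: (eqVneq (c - u c) (P c)) => full; last first.
  by apply: halts_le (halts_child _ _ ct cm mE _); lia.
have {}uc : u c = c - P c by lia.
apply: (@halts_le _ _ _ (8 * c + 14 * m + 45).+2); first lia.
apply: (@halts_follow _ _ push_prog); [by [] | by [] | exact: ch |].
rewrite /= (sh_lvl sh) //.
apply: (@halts_ifeq _ _ push_prog); first by [].
rewrite /=.
have -> : ((if K c is k.+1 then Some (ad (sp k)) else None) == Some (ad c)) = spine K c.
  have := lay_sp_le lay cm; rewrite /spine; case: (K c) => //= k kc.
  by rewrite [LHS](ad_eq sh) //; lia.
case: ifPn => sc.
  have [j [cE KE mE']] := lay_full_spine lay ct cm sc mE uc.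
  apply: halts_le (_ : 14 * m + 33 <= _) _; first lia.
  rewrite cE; apply: (@halts_spine t); rewrite -?cE // => _; lia.
have [Pcm mE'] := lay_climb lay ct cm sc mE uc.
apply: (@halts_le _ _ _ (8 * P c + 14 * m + 50).+2); first lia.
apply: (@halts_move _ _ push_prog); first by [].
apply: (@halts_jump _ _ push_prog); first by [].
by apply: (IH _ Pc t.+1); rewrite //= -ct.
Qed.

Lemma halts_push :
  halts push_prog (22 * m + 60)
    (Config 0 (rf [:: Some 0; Some x; None; None; None; None; None; None]) h)
    pushed.
Proof.
have h0 : 0 < size h by apply: leq_ltn_trans xh.
apply: (@halts_le _ _ _ (22 * m + 57).+3); first lia.
apply: (@halts_follow _ _ push_prog); [by [] | by [] | exact: h0 |].
apply: (@halts_move _ _ push_prog); first by [].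
apply: (@halts_ifeq _ _ push_prog); first by [].
rewrite /= (sh_last sh); case: (posnP m) => m0 /=.
  apply: (@halts_le _ _ _ (14 * m + 33).+2); first lia.
  apply: (@halts_move _ _ push_prog); first by [].
  apply: (@halts_move _ _ push_prog); first by [].
  (* The header is spine node 0, so the first element becomes spine node 1. *)
  have := @halts_spine 0 0 None None None; rewrite /= m0 (sh_0 sh).
  by apply=> //; exact: lay_K0 lay.
apply: halts_le (@halts_climb 0 m _ _ _ _ _ _) => //; first lia.
  by rewrite m0 leqnn.
(* The last element has no children yet, so the climb may start there. *)
by rewrite (lay_last lay m0) addn1.
Qed.

End Push.

End Heap.

(** * Correctness of the operations *)

Section Change.

Variables (disp : Order.disp_t) (U : orderType disp).
Variables (m : nat) (P : nat -> nat) (V V' : nat -> option U) (B : nat -> nat).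
Variable p : nat.

Hypothesis vB : valid m P B.
Hypothesis gB : forall i, 0 < i <= m -> good m P V B i.
Hypothesis V'E : forall i, 0 < i <= m -> i != p -> V' i = V i.

(** By [valid], all values compared at [i] belong to descendants of [i]; if [p] is not among them,
    none has changed. *)
Lemma good_off_change : good_off m P V' B p.
Proof.
move=> i im nai.
have out j : 0 < j <= m -> anc P i j -> V' j = V j.
  by move=> jm ij; apply: V'E => //; apply/eqP => jp; apply: nai; rewrite -jp.
have [Bm aB] := vB im; have [g1 g2] := gB im.
split=> [|j jm Pj]; first by rewrite !out //; exact: anc_refl.
have [Bjm aBj] := vB jm.
by rewrite !out ?g2 //; apply: anc_trans aBj; rewrite -Pj; exact/anc_up/anc_refl.
Qed.

(** A comparison with [p] on the right becomes reflexive, and one with [p] on the left follows from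
    the decrease; both fall under the second alternative of [almost]. *)
Lemma almost_decrease i : ole (V' p) (V p) -> V' p ->
  0 < i <= m -> almost m P V' p B i.
Proof.
move=> dec V'p im; have [Bm _] := vB im; have [g1 g2] := gB im.
have step l : 0 < l <= m -> ole (V (B i)) (V l) ->
    ole (V' (B i)) (V' l) \/ ole (V' p) (V' l).
  move=> lm le; have [->|lp] := eqVneq l p; first by right; exact: ole_refl.
  rewrite (V'E lm lp); have [Bp|Bp] := eqVneq (B i) p.
    by right; apply: ole_trans dec _; rewrite -Bp.
  by left; rewrite V'E.
split=> [|j jm Pj]; first exact: step.
by apply: step; [case: (vB jm) | exact: g2].
Qed.

End Change.

Definition heap_structure : structure 8 0 7 :=
  Structure push_prog peek_prog decrease_prog change_prog.

(** * The invariant and the four operations *)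

Section Invariant.

Variables (disp : Order.disp_t) (U : orderType disp).
Implicit Types (h : memory 0 7 U) (A : seq (entry U)).

Definition places A : seq addr := header :: [seq loc e | e <- A].

(** The returned pointers are the addresses of the data nodes themselves. *)
Definition invariant h A : Prop :=
  [/\ exists P K u, repaired (places A) (size A) P K u h h,
      stores h A &
      forall i e, onth A i = Some e -> handle e = loc e].

Lemma repaired_refl X m P K u h h' :
  repaired X m P K u h h' -> repaired X m P K u h' h'.
Proof. by case=> B [? ? ? [? _]]; exists B. Qed.

Lemma nth_places A i e : onth A i = Some e -> nth 0 (places A) i.+1 = loc e.
Proof.
by move=> Ai; rewrite /= -(odflt_onth 0) onth_map Ai.
Qed.

Lemma onth_lt (T : Type) (s : seq T) i x : onth s i = Some x -> i < size s.
Proof. by move=> si; rewrite -onthTE si. Qed.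

Lemma stores_vals h A : stores h A ->
  forall i, 0 < i <= size A -> vals (places A) h i.
Proof.
move=> sA [//|i] /=; rewrite -onthTE; case Ai: (onth A i) => [e|//] _.
by rewrite /vals (nth_places Ai) [val _ _](sA _ _ Ai).
Qed.

Lemma places_set A i e v : onth A i = Some e ->
  places (set_nth e A i (with_key e v)) = places A.
Proof.
move=> Ai; congr (_ :: _); apply: eq_from_onth => j.
rewrite !onth_map onth_set_nth ?(onth_lt Ai) //.
by case: eqP => // ->; rewrite Ai.
Qed.

Lemma size_set A i e v : onth A i = Some e ->
  size (set_nth e A i (with_key e v)) = size A.
Proof. by move=> Ai; rewrite size_set_nth (maxn_idPr (onth_lt Ai)). Qed.

Lemma stores_lt h A i e : stores h A -> onth A i = Some e -> loc e < size h.
Proof. by move=> sA Ai; apply: val_lt; rewrite [val _ _](sA _ _ Ai). Qed.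

Lemma eq_stores h h' A : val h' =1 val h -> stores h A -> stores h' A.
Proof. by move=> e sA i x Ai; rewrite -(sA i x Ai); exact: e. Qed.

Lemma shape_supply h X m P K u v :
  shape h X m P K u -> shape (supply h v) X m P K u.
Proof.
by apply: eq_shape => [j a _|]; rewrite ?fld_supply // size_supply.
Qed.

Lemma vals_supply h X m P K u v i : shape h X m P K u -> i <= m ->
  vals X (supply h v) i = vals X h i.
Proof.
by move=> sh im; rewrite /vals val_supply ltn_eqF // (shape_lt sh).
Qed.

Lemma push_spec h A v : invariant h A ->
  exists h', call push_prog (100 * (size A).+1) (supply h v) [:: header; size h]
    = Some (Some (size h), h')
  /\ invariant h' (rcons A (Entry (size h) (size h) v)).
Proof.
case=> [[P [K [u [B [sh hB vB [gB _]]]]]] sA hdl].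
have sh1 := shape_supply v sh.
have V1 i : i <= size A -> vals (places A) (supply h v) i = vals (places A) h i.
  exact: vals_supply sh.
have VB i : 0 < i <= size A ->
    vals (places A) (supply h v) (B i) = vals (places A) h (B i).
  by move=> im; rewrite V1 //; have [] := vB i im; lia.
have nX : size h \notin places A.
  by apply/negP => /(sh_lt sh); rewrite ltnn.
have [] := @halts_push _ _ (places A) (size A) P K u (size h) (supply h v) B.
all: rewrite ?fld_supply ?val_supply ?eqxx ?fld_default //.
- by move=> i im; rewrite fld_supply hB.
- move=> i im; have [g1 g2] := gB i im.
  split=> [|j jm Pj]; first by rewrite VB // V1 //; lia.
  by rewrite !VB //; exact: g2.
- by move=> i im; rewrite V1 ?(stores_vals sA) //; lia.
move=> q [h' [e [qE [P' [K' [u' re]]]]]].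
have [q1 [h1 [e1 [qE1 hE1]]]] :
    exists q1 h1, call push_prog (100 * (size A).+1) (supply h v)
      [:: header; size h] = Some (q1, h1) /\ q1 = Some (size h) /\ h1 = h'.
  apply: halts_call; apply: (@halts_le _ _ _ (22 * size A + 60)); first lia.
  by exists q, h'; split.
exists h'; split; first by rewrite e1 qE1 hE1.
split.
- exists P', K', u'; rewrite /places map_rcons size_rcons -rcons_cons.
  exact: repaired_refl re.
- case: re => _ [_ _ _ [_ V']] i x; rewrite -cats1 onth_cat => Ai.
  rewrite [LHS]V' val_supply; move: Ai; case: ltnP => im Ai.
    rewrite ltn_eqF ?[LHS](sA i x Ai) //.
    by apply: (sh_lt sh); rewrite -(nth_places Ai) mem_nth ?(sh_size sh).
  by move/onth1P: Ai => [_ <-]; rewrite /= eqxx.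
move=> i x; rewrite -cats1 onth_cat; case: ifP => _; first exact: hdl.
by move/onth1P => [_ <-].
Qed.

(** By [lay_root], position 1 is the only child of the header. Climbing from any [j] to 1, the
    recorded minima never increase, so [B 1] is a global minimum. *)
Lemma peek_spec h A : invariant h A -> 0 < size A ->
  exists i e, [/\ onth A i = Some e,
    forall j e', onth A j = Some e' -> (key e <= key e')%O &
    call peek_prog 100 h [:: header] = Some (Some (loc e), h)].
Proof.
case=> [[P [K [u [B [sh hB vB [gB _]]]]]] sA hdl] A0.
have lay := sh_lay sh.
have m1 : 0 < 1 <= size A by [].
have [Bm _] := vB 1 m1.
have [e Ae] : exists e, onth A (B 1).-1 = Some e.
  case Ae: (onth A (B 1).-1) (onthTE A (B 1).-1) => [e|]; first by exists e.
  by move=> /esym/negbT; lia.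
have Be : nth 0 (places A) (B 1) = loc e by rewrite -(nth_places Ae) prednK; lia.
have least j : 0 < j <= size A ->
    ole (vals (places A) h (B 1)) (vals (places A) h (B j)).
  elim/ltn_ind: j => j IH jm; have Pj := lay_P lay jm.
  have [Pj0|Pj0] := posnP (P j).
    rewrite (lay_root lay jm Pj0); apply: ole_refl.
    exact: stores_vals.
  have Pm : 0 < P j <= size A by lia.
  by apply: ole_trans (IH _ Pj Pm) _; case: (gB _ Pm) => _; apply.
exists (B 1).-1, e; split=> //.
  move=> j e' Aj; have jm : 0 < j.+1 <= size A := onth_lt Aj.
  have := ole_trans (least _ jm) (proj1 (gB _ jm)).
  rewrite /vals Be (nth_places Aj) [val _ _](sA _ _ Ae) [val _ (loc e')](sA _ _ Aj).
  by [].
have [q [h' [-> [-> ->]]]] : exists q h',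
    call peek_prog 100 h [:: header] = Some (q, h') /\
    q = Some (loc e) /\ h' = h; last by [].
apply: halts_call; apply: (@halts_le _ _ _ 3) => //.
have h0 : 0 < size h by have := shape_lt sh (leq0n _); rewrite (sh_0 sh).
apply: (@halts_follow _ _ peek_prog); [by [] | by [] | exact: h0 |].
rewrite /= (sh_fc sh) A0.
apply: (@halts_follow _ _ peek_prog); [by [] | by [] | exact: shape_lt sh _ |].
apply: halts_halt; first by [].
by rewrite /= (hB _ m1) Be.
Qed.

(** The effect of the initial [CopyVal]: links are untouched, and goodness is known only for the old
    values. *)
Lemma key_update h A i e v : invariant h A -> onth A i = Some e ->
  let X := places A in let m := size A in
  let h1 := putv (supply h v) (loc e) v in
  exists P K u B, [/\ shape h1 X m P K u, bests h1 X m B, valid m P B,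
    forall i, 0 < i <= m -> good m P (vals X h) B i &
    [/\ forall j, 0 < j <= m -> j != i.+1 -> vals X h1 j = vals X h j,
        vals X h1 i.+1 = Some v, vals X h i.+1 = Some (key e) &
        stores h1 (set_nth e A i (with_key e v))]].
Proof.
case=> [[P [K [u [B [sh hB vB [gB _]]]]]] sA hdl] Ai X m h1.
have im := onth_lt Ai; have iX := nth_places Ai.
have lh : loc e < size h by rewrite -iX; exact: shape_lt sh im.
have lh1 : loc e < size (supply h v) by rewrite size_supply; exact: leqW.
have ne j : j <= m -> j != i.+1 -> (nth 0 X j == loc e) = false.
  by move=> jm ji; rewrite -iX (ad_eq sh) //; exact: negPf.
have val1 j : j <= m -> j != i.+1 -> val h1 (nth 0 X j) = val h (nth 0 X j).
  by move=> jm ji; rewrite val_putv // ne // val_supply ltn_eqF // (shape_lt sh).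
exists P, K, u, B; split=> //.
- apply: eq_shape (shape_supply v sh) => [j a _|]; last by rewrite size_putv.
  by rewrite fld_putv.
- by move=> j jm; rewrite fld_putv // fld_supply hB.
split.
- by move=> j jm ji; apply: val1; lia.
- by rewrite /vals iX val_putv // eqxx.
- by rewrite /vals iX; exact: sA Ai.
move=> j x; rewrite onth_set_nth //; case: eqP => [_ [<-]|/eqP ji Aj].
  by rewrite [LHS]val_putv // eqxx.
rewrite -(nth_places Aj) [LHS]val1 ?(onth_lt Aj) //.
by rewrite (nth_places Aj); exact: sA Aj.
Qed.

Lemma invariant_update h h1 A i e v P K u : invariant h A -> onth A i = Some e ->
  stores h1 (set_nth e A i (with_key e v)) ->
  forall h', repaired (places A) (size A) P K u h1 h' ->
  invariant h' (set_nth e A i (with_key e v)).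
Proof.
move=> [_ _ hdl] Ai st h' re; split.
- by exists P, K, u; rewrite places_set ?size_set //; exact: repaired_refl re.
- by apply: eq_stores st; case: re => B [_ _ _ []].
move=> j x; rewrite onth_set_nth ?(onth_lt Ai) //; case: eqP => [_ [<-]|_].
  exact: hdl Ai.
exact: hdl.
Qed.

Lemma decrease_spec h A i e v : invariant h A -> onth A i = Some e ->
  (v <= key e)%O ->
  exists q h', call decrease_prog (100 * alpha i.+1) (supply h v)
      [:: header; handle e; size h] = Some (q, h')
    /\ invariant h' (set_nth e A i (with_key e v)).
Proof.
move=> inv Ai ve; have [_ _ /(_ _ _ Ai) ->] := inv.
have [P [K [u [B [sh hB vB gB [V1 Vp Ve st]]]]]] := key_update v inv Ai.
have im : 0 < i.+1 <= size A := onth_lt Ai; have iX := nth_places Ai.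
have [n [j [nE nK ji]]] := lay_depth (sh_lay sh) (onth_lt Ai).
(* So [n] is at most [2 * alpha i.+1 + 7]; positivity of [alpha] absorbs the additive constants. *)
have aj := sp_alpha ji; have a0 := alpha_gt0 i.+1.
have loopE d : onth decrease_prog (2 + d) = onth (uploop 2) d by [].
have [_ sA _] := inv; have lh := stores_lt sA Ai.
have vlh : val (supply h v) (loc e).
  by rewrite val_supply ltn_eqF // [val _ _](sA _ _ Ai).
have V1p : vals (places A) (putv (supply h v) (loc e) v) i.+1 by rewrite Vp.
have [q [h' [e1 [_ hE]]]] : exists q h', call decrease_prog (100 * alpha i.+1)
    (supply h v) [:: header; loc e; size h] = Some (q, h') /\
    (q = Some (nth 0 (places A) i.+1) /\
     repaired (places A) (size A) P K u (putv (supply h v) (loc e) v) h').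
  apply: halts_call; apply: (@halts_le _ _ _ (7 * n + 2).+2); first lia.
  apply: (@halts_copyval _ _ decrease_prog);
    [by [] | by [] | exact: vlh | by [] | by rewrite val_supply eqxx |].
  apply: (@halts_move _ _ decrease_prog); first by [].
  rewrite /= -iX; apply: (halts_uploop _ loopE) => //.
  - by rewrite iX.
  - by rewrite iX; exact: hB.
  - rewrite iX => d; have [->//|di] := eqVneq d i.+1 => dm.
    by rewrite V1 //; exact: stores_vals.
  - exact: anc_refl.
  - exact: vB.
  - move=> d dm; rewrite iX; apply: (almost_decrease vB gB V1) => //.
    by rewrite Vp Ve.
  by rewrite iX; exact: good_off_change vB gB V1.
by exists q, h'; split=> //; exact: invariant_update inv Ai st _ hE.
Qed.

Lemma change_spec h A i e v : invariant h A -> onth A i = Some e ->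
  exists q h', call change_prog (100 * i.+1) (supply h v)
      [:: header; handle e; size h] = Some (q, h')
    /\ invariant h' (set_nth e A i (with_key e v)).
Proof.
move=> inv Ai; have [_ sA /(_ _ _ Ai) ->] := inv.
have [P [K [u [B [sh hB vB gB [V1 Vp Ve st]]]]]] := key_update v inv Ai.
have im : 0 < i.+1 <= size A := onth_lt Ai; have iX := nth_places Ai.
have lh := stores_lt sA Ai.
have vlh : val (supply h v) (loc e).
  by rewrite val_supply ltn_eqF // [val _ _](sA _ _ Ai).
have [q [h' [e1 [_ hE]]]] : exists q h', call change_prog (100 * i.+1)
    (supply h v) [:: header; loc e; size h] = Some (q, h') /\
    (q = Some (nth 0 (places A) i.+1) /\
     repaired (places A) (size A) P K u (putv (supply h v) (loc e) v) h').
  apply: halts_call; apply: (@halts_le _ _ _ (21 * i.+1 + 2).+2); first lia.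
  apply: (@halts_copyval _ _ change_prog);
    [by [] | by [] | exact: vlh | by [] | by rewrite val_supply eqxx |].
  apply: (@halts_move _ _ change_prog); first by [].
  rewrite /= -iX; apply: halts_repair => //.
  - by rewrite iX.
  - by rewrite iX; exact: hB.
  - rewrite iX => d; have [->|di] := eqVneq d i.+1 => dm; first by rewrite Vp.
    by rewrite V1 //; exact: stores_vals.
  - exact: vB.
  by rewrite iX; exact: good_off_change vB gB V1.
by exists q, h'; split=> //; exact: invariant_update inv Ai st _ hE.
Qed.

Lemma invariant0 : invariant [:: blank] [::].
Proof.
split=> //; try by move=> i e; rewrite onth0n.
exists (fun=> 0), (fun=> 1), (fun=> 0), id; split=> //; try by case=> [|i].
  split=> //; try by case=> [|i].
  exact: layout0.
by split=> //; case.
Qed.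

Lemma call_det P t t' h args x y :
  @call 8 0 7 disp U P t h args = Some x -> call P t' h args = Some y -> x = y.
Proof. exact: run_det. Qed.

Lemma reachable_invariant h A : reachable heap_structure h A -> invariant h A.
Proof.
elim=> {h A} [|h A v t p h' _ inv e|h A t p h' _ inv A0 e
  |h A i x v t p h' _ inv Ai vx e|h A i x v t p h' _ inv Ai e].
- exact: invariant0.
- by have [h1 [e1 inv1]] := push_spec v inv; case: (call_det e e1) => -> ->.
- have [i [x [_ _ e1]]] := peek_spec inv A0.
  by case: (call_det e e1) => _ ->.
- have [q [h1 [e1 inv1]]] := decrease_spec inv Ai vx.
  by case: (call_det e e1) => _ ->.
- have [q [h1 [e1 inv1]]] := change_spec v inv Ai.
  by case: (call_det e e1) => _ ->.
Qed.

End Invariant.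

Theorem theorem5 :
  exists (r b d : nat) (D : structure r b d) (c : nat),
  forall (disp : Order.disp_t) (U : orderType disp)
         (h : memory b d U) (A : seq (entry U)),
  reachable D h A ->
  (* Push *)
  (forall v : U, exists (p : addr) (h' : memory b d U),
     call (push D) (c * (size A).+1) (supply h v) [:: header; size h]
       = Some (Some p, h')
     /\ stores h' (rcons A (Entry (size h) p v)))
  /\
  (* Peek *)
  (0 < size A -> exists (i : nat) (e : entry U) (h' : memory b d U),
     onth A i = Some e
     /\ (forall (j : nat) (e' : entry U),
           onth A j = Some e' -> (key e <= key e')%O)
     /\ call (peek D) c h [:: header] = Some (Some (loc e), h')
     /\ stores h' A)
  /\
  (* DecreaseKey; positions are counted from 0, so A[i] is at position i - 1 *)
  (forall (i : nat) (e : entry U) (v : U),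
     onth A i = Some e -> (v <= key e)%O ->
     exists (q : pointer) (h' : memory b d U),
       call (decrease_key D) (c * alpha i.+1)
            (supply h v) [:: header; handle e; size h] = Some (q, h')
       /\ stores h' (set_nth e A i (with_key e v)))
  /\
  (* ChangeKey *)
  (forall (i : nat) (e : entry U) (v : U),
     onth A i = Some e ->
     exists (q : pointer) (h' : memory b d U),
       call (change_key D) (c * i.+1)
            (supply h v) [:: header; handle e; size h] = Some (q, h')
       /\ stores h' (set_nth e A i (with_key e v))).
Proof.
(* No bits are needed, as levels are encoded by pointers. The factor 100 covers [22 * m + 60] for
   Push, 3 for Peek, [14 * alpha i.+1 + 53] for DecreaseKey and [21 * i.+1 + 4] for ChangeKey. *)
exists 8, 0, 7, heap_structure, 100 => disp U h A /reachable_invariant inv.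
split=> [v|].
  have [h' [e [_ st _]]] := push_spec v inv.
  by exists (size h), h'.
split=> [A0|].
  have [i [e [Ai least eq]]] := peek_spec inv A0.
  by exists i, e, h; split=> //; split=> //; split=> //; case: inv.
split=> [i e v Ai ve|i e v Ai].
  have [q [h' [eq [_ st _]]]] := decrease_spec inv Ai ve.
  by exists q, h'.
have [q [h' [eq [_ st _]]]] := change_spec v inv Ai.
by exists q, h'.
Qed.
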